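(* Let $H$ be a connected, subcubic, triangle-free graph which is minimal with respect to Reductions 1–4, i.e. (R1) $H$ has no vertex of degree $1$; (R2) $H$ has no two adjacent vertices both of degree $2$; (R3) $H$ has no induced $4$-cycle $w_1w_2w_3w_4$ with $d(w_1)=d(w_3)=2$; (R4) $H$ has no cut-edge. If $H$ contains no (not necessarily induced) subgraph isomorphic to $S_{3,3,3}$ and no cycle of length $5$, then $H$ is isomorphic to $D_{6i+1}$ for some $i\ge1$, or $H$ is isomorphic to $D_{6i+5}$ for some $i\ge 1$, or $H$ is $3$-edge-colorable.
   Context: All graphs are finite, simple and undirected; $d(v)$ denotes the degree of $v$ in $H$; subcubic means maximum degree at most $3$. $S_{a,b,c}$ is the tree consisting of three paths of lengths (numbers of edges) $a,b,c$ sharing exactly one common endvertex. $3$-edge-colorable means having a proper edge coloring with at most $3$ colors. Families $D$: for $i\ge1$ let $F_1,\dots,F_i$ be vertex-disjoint copies of $K_{3,3}$ minus one edge, and in $F_m$ let $a_m,b_m$ be its two vertices of degree $2$. $D_{6i+1}$ is obtained from $F_1\cup\dots\cup F_i$ by adding the edges $b_m a_{m+1}$ ($1\le m\le i-1$), a new vertex $x$, and the edges $b_i x$, $x a_1$. $D_{6i+5}$ is obtained from $F_1\cup\dots\cup F_i$ together with a further disjoint copy $T$ of $K_{2,3}$ with bipartition $\{q,s\}$, $\{p,r,t\}$, by adding the edges $b_m a_{m+1}$ ($1\le m\le i-1$), $b_i p$ and $r a_1$. *)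

(* Defs.v *)
From mathcomp Require Import all_boot.

Set Implicit Arguments.
Unset Strict Implicit.
Unset Printing Implicit Defensive.

Record sgraph := SGraph {
  vertex :> finType;
  edge : rel vertex;
  edge_sym : symmetric edge;
  edge_irr : irreflexive edge
}.

(* The simple graph whose edges are the pairs {u, v}, u != v, with
   [arc u v] or [arc v u]. *)
Section OfArcs.
Variables (T : finType) (arc : rel T).

Definition arcs_edge : rel T := [rel u v | (u != v) && (arc u v || arc v u)].

Lemma arcs_edge_sym : symmetric arcs_edge.
Proof. by move=> u v; rewrite /arcs_edge /= eq_sym orbC. Qed.

Lemma arcs_edge_irr : irreflexive arcs_edge.
Proof. by move=> u; rewrite /arcs_edge /= eqxx. Qed.

Definition graph_of_arcs : sgraph := SGraph arcs_edge_sym arcs_edge_irr.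
End OfArcs.

Definition iso (G H : sgraph) : Prop :=
  exists2 f : G -> H, bijective f & forall x y : G, edge (f x) (f y) = edge x y.

(* F is isomorphic to a (not necessarily induced) subgraph of H. *)
Definition has_subgraph (F H : sgraph) : Prop :=
  exists2 f : F -> H, injective f & forall x y : F, edge x y -> edge (f x) (f y).

Section Notions.
Variable H : sgraph.
Implicit Types (u v w : H) (c : seq H).

Definition degree v : nat := #|[set w | edge v w]|.

Definition subcubic : Prop := forall v, degree v <= 3.

Definition connected_graph : Prop := forall u v, connect (@edge H) u v.

Definition is_cycle c : bool := (2 < size c) && ucycleb (@edge H) c.

Definition has_cycle_of_length (n : nat) : Prop :=
  exists2 c, is_cycle c & size c = n.

Definition triangle_free : Prop := ~ has_cycle_of_length 3.

Definition is_induced_cycle c : Prop :=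
  is_cycle c /\
  {in c &, forall u v, edge u v -> (v == next c u) || (u == next c v)}.

Definition del_edge u v : rel H :=
  [rel x y | edge x y && ([set x; y] != [set u; v])].

(* A cut-edge is an edge whose deletion increases the number of components. *)
Definition cut_edge u v : Prop :=
  edge u v /\ n_comp (@edge H) predT < n_comp (del_edge u v) predT.

Definition reduced1 : Prop := forall v, degree v <> 1.

Definition reduced2 : Prop :=
  ~ exists u v, [/\ edge u v, degree u = 2 & degree v = 2].

Definition reduced3 : Prop :=
  ~ exists w1 w2 w3 w4,
      [/\ is_induced_cycle [:: w1; w2; w3; w4], degree w1 = 2 & degree w3 = 2].

Definition reduced4 : Prop := ~ exists u v, cut_edge u v.

Definition edges : {set {set H}} :=
  [set e | [exists u, exists v, edge u v && (e == [set u; v])]].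

(* [f] is only constrained on [edges]; its other values are junk. *)
Definition edge_colorable (k : nat) : Prop :=
  exists f : {set H} -> 'I_k,
    {in edges &, forall e1 e2 : {set H},
       e1 != e2 -> e1 :&: e2 != set0 -> f e1 != f e2}.
End Notions.

(* S_{a,b,c}: [None] is the common endvertex, and the vertex [k] of a leg is at
   distance [k.+1] from it. *)
Definition spider_arc (a b c : nat) : rel (option ('I_a + 'I_b + 'I_c)) :=
  fun u v => match u, v with
  | None, Some (inl (inl k)) => k == 0 :> nat
  | None, Some (inl (inr k)) => k == 0 :> nat
  | None, Some (inr k) => k == 0 :> nat
  | Some (inl (inl k)), Some (inl (inl l)) => l == k.+1 :> nat
  | Some (inl (inr k)), Some (inl (inr l)) => l == k.+1 :> nat
  | Some (inr k), Some (inr l) => l == k.+1 :> nat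
  | _, _ => false
  end.

Definition spider (a b c : nat) : sgraph := graph_of_arcs (@spider_arc a b c).

(* K_{3,3} with parts [(false, _)] and [(true, _)], minus the edge joining the
   two vertices of index 0, which are the vertices a and b of degree 2. *)
Definition K33m : finType := (bool * 'I_3)%type.
Definition K33m_arc : rel K33m :=
  fun u v => [&& ~~ u.1, v.1 & (u.2 != ord0) || (v.2 != ord0)].
Definition K33m_a : K33m := (false, ord0).
Definition K33m_b : K33m := (true, ord0).

(* The chain F_1, ..., F_i with the edges b_m a_{m+1}; the copies are numbered
   from 0. *)
Definition chain (i : nat) : finType := ('I_i * K33m)%type.
Definition chain_arc (i : nat) : rel (chain i) :=
  fun u v => ((u.1 == v.1) && K33m_arc u.2 v.2)
    || [&& v.1 == u.1.+1 :> nat, u.2 == K33m_b & v.2 == K33m_a].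
Definition is_first_a (i : nat) (u : chain i) : bool :=
  (u.1 == 0 :> nat) && (u.2 == K33m_a).
Definition is_last_b (i : nat) (u : chain i) : bool :=
  (u.1.+1 == i :> nat) && (u.2 == K33m_b).

(* D_{6i+1}, with [None] the vertex x. *)
Definition D1_arc (i : nat) : rel (option (chain i)) :=
  fun u v => match u, v with
  | Some u', Some v' => chain_arc u' v'
  | Some u', None => is_last_b u'
  | None, Some v' => is_first_a v'
  | None, None => false
  end.
Definition D1 (i : nat) : sgraph := graph_of_arcs (@D1_arc i).

(* K_{2,3} with parts {q, s} = [inl _] and {p, r, t} = [inr _], where p, r, t
   are [inr 0], [inr 1], [inr 2]. *)
Definition K23 : finType := ('I_2 + 'I_3)%type.
Definition K23_arc : rel K23 :=
  fun u v => match u, v with inl _, inr _ => true | _, _ => false end.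
Definition K23_p : K23 := inr (inord 0).
Definition K23_r : K23 := inr (inord 1).

(* D_{6i+5} *)
Definition D5_arc (i : nat) : rel (chain i + K23) :=
  fun u v => match u, v with
  | inl u', inl v' => chain_arc u' v'
  | inl u', inr v' => is_last_b u' && (v' == K23_p)
  | inr u', inl v' => (u' == K23_r) && is_first_a v'
  | inr u', inr v' => K23_arc u' v'
  end.
Definition D5 (i : nat) : sgraph := graph_of_arcs (@D5_arc i).

(* Main.v *)
Require Import Defs.
From mathcomp Require Import all_boot.
From mathcomp Require Import fingroup perm zify.

(* If H is bipartite, it is 3-edge-colourable by Koenig's theorem. Otherwise let
   C be a shortest odd cycle; its length is at least 7. C is isometric up to
   parity, so a vertex off C has its neighbours on C at distance 2 from each
   other, and two adjacent vertices off C have theirs at distance 1 or 3. A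
   vertex of degree 3 of C is the centre of an S_{3,3,3} as soon as a path of
   length 3 leaves C there; hence the components of H - C are single vertices
   or edges, and they group with at most four consecutive vertices of C into
   pieces: K_{2,3}, K_{3,3} minus one edge, or K_{3,3} minus two disjoint edges.
   So H is a ring of pieces and of single vertices of degree 2. In a 3-edge-
   colouring the two edges that leave a piece have different colours at a K_{2,3}
   or a single vertex, the same colour at a K_{3,3} minus an edge, and arbitrary
   colours at a K_{3,3} minus two edges. As C is odd, the number of pieces of the
   first kind is odd, so the colouring exists unless that number is 1 and all
   other pieces are K_{3,3} minus an edge, that is, unless H is one of the D_n. *)

Set Implicit Arguments.
Unset Strict Implicit.
Unset Printing Implicit Defensive.

(** * Edge colourings from symmetric functions of two vertices *)

(** The colour of an edge set is read off an ordering of its ends found by [pick]; symmetry of [g]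
    on edges makes the choice immaterial. *)
Lemma edge_coloring_of_pairs (H : sgraph) k (g : H -> H -> 'I_k.+1) :
  (forall x y, edge x y -> g x y = g y x) ->
  (forall x y z, edge x y -> edge x z -> y != z -> g x y != g x z) ->
  edge_colorable H k.+1.
Proof.
move=> g_sym g_proper.
pose f (e : {set H}) : 'I_k.+1 :=
  if [pick p : H * H | edge p.1 p.2 && (e == [set p.1; p.2])] is Some p
  then g p.1 p.2 else ord0.
have fE x y : edge x y -> f [set x; y] = g x y.
  move=> exy; rewrite /f; case: pickP => [[a b] /= /andP[eab /eqP xyab]|].
    have: x \in [set a; b] by rewrite -xyab set21.
    have: y \in [set a; b] by rewrite -xyab set22.
    have nxy: x != y by apply/eqP => xy; rewrite xy edge_irr in exy.
    rewrite !inE => /orP[]/eqP ya /orP[]/eqP xa; subst => //.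
    - by rewrite eqxx in nxy.
    - exact: g_sym.
    - by rewrite eqxx in nxy.
  by move=> /(_ (x, y)); rewrite /= exy eqxx.
exists f => e1 e2.
rewrite !inE => /existsP[a /existsP[b /andP[eab /eqP->]]].
move=> /existsP[x /existsP[y /andP[exy /eqP->]]] ne /set0Pn[z].
(* Both edges are rewritten with their common end [z] first, the form that [g_proper] expects. *)
have norm u v : edge u v -> z \in [set u; v] ->
    exists2 w, edge z w & [set u; v] = [set z; w].
  rewrite !inE => euv /orP[]/eqP->; first by exists v.
  by exists u; [rewrite edge_sym | rewrite setUC].
rewrite inE => /andP[/(norm _ _ eab)[b' eb' Eb] /(norm _ _ exy)[y' ey' Ey]].
rewrite Eb Ey !fE //; apply: g_proper => //.
by apply: contra_neq ne => by'; rewrite Eb Ey by'.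
Qed.

(** * Koenig's theorem *)

Lemma connect_last (T : finType) (r : rel T) u v :
  connect r u v -> v = u \/ exists2 z, connect r u z & r z v.
Proof.
case/connectP => p; case/lastP: p => [|p z] /=; first by move=> _ ->; left.
rewrite rcons_path last_rcons => /andP[pp rz] ->; right.
by exists (last u p) => //; apply/connectP; exists p.
Qed.

(* Kempe exchange. Orienting the edges of colours [a], [b] so that vertices of
   u's side emit [b] and the others emit [a], the walk from [u] never enters
   [v], which has no [b]-edge. *)
Lemma konig_edge_coloring (T : finType) k (side : T -> bool) (e : rel T) :
  symmetric e -> (forall x y, e x y -> side x != side y) ->
  (forall x, #|[set y | e x y]| <= k.+1) ->
  exists g : T -> T -> 'I_k.+1,
    (forall x y, e x y -> g x y = g y x) /\
    (forall x y z, e x y -> e x z -> y != z -> g x y != g x z).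
Proof.
move=> + + +; have [m] := ubnP #|[set p : T * T | e p.1 p.2]|.
elim: m e => // m IHm e lem e_sym e_side e_deg.
case: (pickP (fun p : T * T => side p.1 && e p.1 p.2)) => [[u v] /= /andP[su euv]|no]; last first.
  have noe x y : e x y = false.
    apply/negP => exy; case sx: (side x).
      by have := no (x, y); rewrite /= sx exy.
    have := no (y, x); rewrite /= e_sym exy andbT => sy.
    by have := e_side _ _ exy; rewrite sx sy.
  by exists (fun _ _ => ord0); split=> [//|x y z]; rewrite noe.
have sv : side v = false by have := e_side _ _ euv; rewrite su; case: (side v).
pose e' x y := e x y && ((x, y) != (u, v)) && ((x, y) != (v, u)).
have sub x y : e' x y -> e x y by case/andP => /andP[].
have e'_sym : symmetric e'.
  by move=> x y; rewrite /e' e_sym -!andbA; congr (_ && _); rewrite andbC !xpair_eqE ![(x == _) && _]andbC.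
have e'uv : e' u v = false by rewrite /e' eqxx andbF.
have e'vu : e' v u = false by rewrite e'_sym.
have [||x|g [g_sym g_proper]] := IHm e' _ e'_sym.
- rewrite ltnS in lem; apply: leq_trans lem; apply: proper_card.
  apply/properP; split; first by apply/subsetP => -[x y]; rewrite !inE /=; apply: sub.
  by exists (u, v); rewrite !inE /= ?e'uv.
- by move=> x y /sub/e_side.
- apply: leq_trans (e_deg x); apply/subset_leq_card/subsetP => y; rewrite !inE; exact: sub.
(* Without the deleted edge at most [k] edges remain at [x], so one of the [k.+1] colours is free
   there. *)
have missing x y : e x y -> e' x y = false ->
    exists a, forall z, e' x z -> g x z != a.
  move=> exy e'xy.
  have lt : #|[set g x z | z in [set z | e' x z]]| < #|'I_k.+1|.
    rewrite card_ord; apply: leq_ltn_trans (leq_imset_card _ _) _.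
    apply: leq_trans (e_deg x); apply: proper_card; apply/properP; split.
      by apply/subsetP => z; rewrite !inE; exact: sub.
    by exists y; rewrite !inE ?e'xy.
  case: (pickP (fun a => a \notin [set g x z | z in [set z | e' x z]])) => [a na|all].
    exists a => z e'z; apply: contraNneq na => <-; apply/imsetP; exists z => //.
    by rewrite inE.
  rewrite ltnNge in lt; case/negP: lt; rewrite -cardsT; apply/subset_leq_card/subsetP => a _.
  by have := all a; move/negbFE.
have [a ua] := missing _ _ euv e'uv.
have [b vb] := missing _ _ (eq_trans (e_sym v u) euv) e'vu.
pose r x y := e' x y && (g x y == if side x then b else a).
pose R := connect r u.
have vR : ~~ R v.
  apply/negP => /connect_last[vu|[z _]]; first by rewrite -vu sv in su.
  case/andP=> ezv; have := e_side _ _ (sub _ _ ezv); rewrite sv => sz.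
  have -> : side z by case: (side z) sz.
  by apply/negP; rewrite g_sym // vb // e'_sym.
(* [R] is closed under all edges coloured [a] or [b]: one that runs against the orientation is the
   edge by which the walk came in, and [u] itself has no [a]-edge. *)
have Rcl x y : R x -> e' x y -> (g x y == a) || (g x y == b) -> R y.
  move=> Rx exy gab.
  have [rxy|nr] := boolP (r x y); first exact: connect_trans Rx (connect1 rxy).
  have {nr gab} gxy : g x y = if side x then a else b.
    by move: nr gab; rewrite /r exy /=; case: (side x) => /negPf->; rewrite ?orbF => /eqP.
  case: (connect_last Rx) => [xu|[z Rz /andP[ezx]]].
    by move: gxy; rewrite xu su => /eqP; rewrite (negPf (ua _ _)) // -xu.
  have [<-//|nzy] := eqVneq z y.
  have := g_proper x z y; rewrite e'_sym => /(_ ezx exy nzy).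
  rewrite gxy -(g_sym _ _ ezx); have := e_side _ _ (sub _ _ ezx).
  by case: (side z); case: (side x) => //= _ /negPf->.
pose h x y := if R x then tperm a b (g x y) else g x y.
have h_sym x y : e' x y -> h x y = h y x.
  move=> exy; rewrite /h -(g_sym _ _ exy).
  have [gab|] := boolP ((g x y == a) || (g x y == b)); last first.
    by rewrite negb_or => /andP[ga gb]; rewrite tpermD 1?eq_sym //; do 2!case: ifP.
  suff -> : R x = R y by [].
  apply/idP/idP => [/Rcl|/Rcl]; first by apply.
  by apply; rewrite 1?e'_sym // -g_sym.
have h_proper x y z : e' x y -> e' x z -> y != z -> h x y != h x z.
  move=> exy exz /(g_proper _ _ _ exy exz); rewrite /h; case: ifP => // _.
  by rewrite (inj_eq perm_inj).
have hu y : e' u y -> h u y != b.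
  by move=> euy; rewrite /h /R connect0 -[X in _ != X](tpermL a b) (inj_eq perm_inj) ua.
have hv y : e' v y -> h v y != b by move=> evy; rewrite /h (negPf vR) vb.
(* After the exchange [b] is free at both [u] and [v], so it colours the restored edge. *)
exists (fun x y => if e' x y then h x y else b); split=> [x y exy|x y z exy exz nyz].
  by rewrite e'_sym; case: ifP => // e'yx; apply: h_sym; rewrite e'_sym.
have new w : e x w -> e' x w = false -> x = u /\ w = v \/ x = v /\ w = u.
  rewrite /e' => -> /=; case: (_ =P (u, v)) => [[-> ->]|_]; first by left.
  by case: (_ =P (v, u)) => [[-> ->]|_] //; right.
have miss w t : e x w -> e' x w = false -> e' x t -> h x t != b.
  by move=> exw /(new _ exw)[[-> _]|[-> _]]; [apply: hu | apply: hv].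
case e'y: (e' x y); case e'z: (e' x z).
- exact: h_proper.
- exact: miss exz e'z e'y.
- by rewrite eq_sym; exact: miss exy e'y e'z.
- case: (new _ exy e'y) (new _ exz e'z) => [[xu yv]|[xv yu]] [[xu' zv]|[xv' zu]].
  + by rewrite yv zv eqxx in nyz.
  + by rewrite -xu xv' sv in su.
  + by rewrite -xu' xv sv in su.
  + by rewrite yu zu eqxx in nyz.
Qed.

(** * Isomorphism from local degrees *)

(** Counting shows that every neighbour of [f x] comes from a neighbour of [x]. So the image is
    closed under adjacency, hence everything by connectedness, and edges lift back. *)
Lemma iso_of_covering (G H : sgraph) (f : G -> H) (x0 : G) :
  connected_graph H -> injective f ->
  (forall x y, edge x y -> edge (f x) (f y)) ->
  (forall x, exists s : seq G,
     [/\ uniq s, all (edge x) s & degree (f x) <= size s]) ->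
  iso H G.
Proof.
move=> Hconn f_inj f_hom f_deg.
have nbr x y : edge (f x) y -> exists2 z, edge x z & f z = y.
  move=> exy; have [s [us es ds]] := f_deg x.
  have sub : [set f z | z in s] \subset [set w | edge (f x) w].
    by apply/subsetP => _ /imsetP[z zs ->]; rewrite inE f_hom // (allP es).
  have : [set f z | z in s] == [set w | edge (f x) w].
    rewrite eqEcard sub /= card_imset //; apply: leq_trans ds _.
    by rewrite -(card_uniqP us).
  move/eqP/setP/(_ y); rewrite !inE exy => /imsetP[z zs ->].
  by exists z => //; apply: (allP es).
have f_surj y : exists z, f z == y.
  have /connectP[p] := Hconn (f x0) y.
  elim: p x0 => [|a p IHp] x /=; first by move=> _ ->; exists x.
  by case/andP=> /nbr[z _ <-]; apply: IHp.
pose h y := xchoose (f_surj y).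
have hK : cancel h f by move=> y; apply/eqP/(xchooseP (f_surj y)).
have fK : cancel f h by move=> x; apply: f_inj; rewrite hK.
exists h; first by exists f.
move=> x y; apply/idP/idP => [/f_hom|]; first by rewrite !hK.
by rewrite -[x in edge x]hK -{1}[y]hK => /nbr[z exz /f_inj<-].
Qed.

(** * Odd closed walks *)

Section Walks.
Variable H : sgraph.
Implicit Types u v w : H.

(** Boolean, so that [ex_minnP] can select a shortest odd closed walk; vertices may repeat. *)
Fixpoint walk n u v : bool :=
  if n is m.+1 then [exists w, edge u w && walk m w v] else u == v.

Lemma walk_edge u v : edge u v -> walk 1 u v.
Proof. by move=> e; apply/existsP; exists v; rewrite e /=. Qed.

Lemma walk_cat m n u v w : walk m u v -> walk n v w -> walk (m + n) u w.
Proof.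
elim: m u => [|m IHm] u /=; first by move/eqP->.
case/existsP=> x /andP[eux xv] vw; apply/existsP; exists x.
by rewrite eux IHm.
Qed.

Lemma walk_sym n u v : walk n u v -> walk n v u.
Proof.
elim: n u => [|n IHn] u; first by rewrite /= eq_sym.
case/existsP=> x /andP[eux /IHn xv].
by rewrite -addn1; apply: walk_cat xv _; apply: walk_edge; rewrite edge_sym.
Qed.

Lemma walkP n u v : walk n u v ->
  exists f : nat -> H, [/\ f 0 = u, f n = v & forall i, i < n -> edge (f i) (f i.+1)].
Proof.
elim: n u => [|n IHn] u /=; first by move/eqP->; exists (fun=> v).
case/existsP=> x /andP[eux /IHn[f [f0 fn fe]]].
exists (fun i => if i is j.+1 then f j else u); split=> //.
by case=> [|i]; rewrite ?f0 // => /fe.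
Qed.

Lemma walk_of_fun (f : nat -> H) i n :
  (forall j, i <= j < i + n -> edge (f j) (f j.+1)) -> walk n (f i) (f (i + n)).
Proof.
elim: n => [|n IHn] fe; first by rewrite addn0 /=.
rewrite -addn1; apply: (@walk_cat _ _ _ (f (i + n))).
  by apply: IHn => j lj; apply: fe; lia.
by rewrite addn1 addnS; apply/walk_edge/fe; lia.
Qed.

Lemma walk_of_connect u v : connect (@edge H) u v -> exists n, walk n u v.
Proof.
case/connectP=> p pp ->; exists (size p).
elim: p u pp => //= x p IHp u /andP[eux pp].
by apply/existsP; exists x; rewrite eux IHp.
Qed.

(** Each vertex is classed by the parity of some walk from a root [r]. An edge whose ends agree
    closes two such walks into an odd one. *)
Lemma odd_closed_walk_or_2coloring : connected_graph H ->
  (exists n, odd n && [exists u, walk n u u]) \/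
  (exists side : H -> bool, forall x y, edge x y -> side x != side y).
Proof.
move=> Hconn; case: (pickP (@predT H)) => [r _|no]; last first.
  by right; exists (fun=> true) => x; have := no x.
have [N rN] := fin_all_exists (fun v => walk_of_connect (Hconn r v)).
case: (pickP (fun p : H * H => edge p.1 p.2 && (odd (N p.1) == odd (N p.2)))).
  case=> u v /= /andP[euv /eqP same]; left; exists (N u + 1 + N v).
  apply/andP; split; first by rewrite !oddD same /= addbT addNb addbb.
  apply/existsP; exists r; apply: walk_cat (walk_sym (rN v)).
  by apply: walk_cat (rN u) (walk_edge euv).
move=> no; right; exists (fun v => odd (N v)) => x y exy.
by have := no (x, y); rewrite /= exy /= => ->.
Qed.

End Walks.

(** * Neighbourhoods, spiders and induced 4-cycles *)

Lemma degree3_nbrs (H : sgraph) (v a b d y : H) : degree v <= 3 ->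
  edge v a -> edge v b -> edge v d -> a != b -> a != d -> b != d ->
  edge v y -> [|| y == a, y == b | y == d].
Proof.
move=> dv va vb vd ab ad bd vy; apply/negPn/negP; rewrite !negb_or => /and3P[ya yb yd].
have us : uniq [:: y; a; b; d] by rewrite /= !inE !negb_or ya yb yd ab ad bd.
move: dv; rewrite leqNgt => /negP; apply; rewrite /degree.
have <- : #|[:: y; a; b; d]| = 4 by apply/card_uniqP.
by apply/subset_leq_card/subsetP => u; rewrite !inE => /or4P[]/eqP->.
Qed.

Lemma degree_neq1_nbr (H : sgraph) (v a : H) : degree v <> 1 -> edge v a ->
  exists2 b, edge v b & b != a.
Proof.
move=> dv va; case: (pickP (fun b => edge v b && (b != a))) => [b /andP[]|no].
  by exists b.
case: dv; rewrite /degree -(cards1 a); apply: eq_card => b; rewrite !inE.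
by have := no b; case: eqP => [->|_] //=; rewrite andbT.
Qed.

Lemma degree2 (H : sgraph) (v a b : H) : edge v a -> edge v b -> a != b ->
  (forall y, edge v y -> y = a \/ y = b) -> degree v = 2.
Proof.
move=> va vb ab vy; rewrite /degree.
have -> : [set w | edge v w] = [set a; b].
  apply/setP => y; rewrite !inE; apply/idP/idP => [/vy[]->|/orP[]/eqP->] //.
    by rewrite eqxx.
  by rewrite eqxx orbT.
by rewrite cards2 ab.
Qed.

(** Follows the order of the list in [spider333], the centre first and each leg outwards, so that
    injectivity of the embedding becomes [uniq] of that list. *)
Definition spider333_code (u : spider 3 3 3) : nat :=
  match u with
  | None => 0
  | Some (inl (inl k)) => 1 + k
  | Some (inl (inr k)) => 4 + k
  | Some (inr k) => 7 + k
  end.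

Lemma spider333_code_lt u : spider333_code u < 10.
Proof. by case: u => [[[k|k]|k]|] //=; have := ltn_ord k; lia. Qed.

Lemma spider333_code_inj : injective spider333_code.
Proof.
move=> [[[k|k]|k]|] [[[l|l]|l]|] //=; try have ltk := ltn_ord k; try have ltl := ltn_ord l.
all: try by (move=> ?; lia).
- by move=> e; congr (Some (inl (inl _))); apply: val_inj => /=; lia.
- by move=> e; congr (Some (inl (inr _))); apply: val_inj => /=; lia.
- by move=> e; congr (Some (inr _)); apply: val_inj => /=; lia.
Qed.

Lemma spider333 (H : sgraph) (z x1 x2 x3 y1 y2 y3 z1 z2 z3 : H) :
  edge z x1 -> edge x1 x2 -> edge x2 x3 ->
  edge z y1 -> edge y1 y2 -> edge y2 y3 ->
  edge z z1 -> edge z1 z2 -> edge z2 z3 ->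
  uniq [:: z; x1; x2; x3; y1; y2; y3; z1; z2; z3] ->
  has_subgraph (spider 3 3 3) H.
Proof.
move=> e1 e2 e3 e4 e5 e6 e7 e8 e9.
set s := [:: z; _; _; _; _; _; _; _; _; _] => us.
pose code := spider333_code.
exists (fun u => nth z s (code u)).
  by move=> u v /eqP; rewrite nth_uniq ?spider333_code_lt // => /eqP/spider333_code_inj.
have arc u v : spider_arc u v -> edge (nth z s (code u)) (nth z s (code v)).
  by case: u v => [[[[[|[|[|//]]] ?]|[[|[|[|//]]] ?]]|[[|[|[|//]]] ?]]|] //=;
    case=> [[[[[|[|[|//]]] ?]|[[|[|[|//]]] ?]]|[[|[|[|//]]] ?]]|] //=.
move=> u v /andP[_ /orP[/arc//|/arc]]; by rewrite edge_sym.
Qed.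

Lemma induced_c4 (H : sgraph) (a b u d : H) :
  edge a b -> edge b u -> edge u d -> edge d a ->
  ~~ edge a u -> ~~ edge b d -> a != u -> b != d ->
  is_induced_cycle [:: a; b; u; d].
Proof.
have ne (x y : H) : edge x y -> (x == y) = false.
  by move=> exy; apply/negP => /eqP xy; rewrite xy edge_irr in exy.
move=> eab ebu eud eda au bd nau nbd.
have sym (x y : H) : x != y -> (x == y) = false /\ (y == x) = false.
  by rewrite [y == x]eq_sym => /negPf->.
have [[n1 n1'] [n2 n2']] := (sym _ _ nau, sym _ _ nbd).
have ne' (x y : H) : edge x y -> (y == x) = false by rewrite eq_sym; apply: ne.
have E := (ne _ _ eab, ne _ _ ebu, ne _ _ eud, ne _ _ eda,
  ne' _ _ eab, ne' _ _ ebu, ne' _ _ eud, ne' _ _ eda, n1, n2, n1', n2').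
split; first by rewrite /is_cycle /ucycleb /= eab ebu eud eda !inE !E.
move=> x y; rewrite !inE => /or4P[]/eqP-> /or4P[]/eqP-> e;
  try (by rewrite edge_irr in e); rewrite /next /= ?eqxx ?E ?eqxx ?orbT //.
- by rewrite e in au.
- by rewrite e in bd.
- by rewrite edge_sym e in au.
- by rewrite edge_sym e in bd.
Qed.

(** * Pieces and their colourings *)

(* A piece occupies [len t] consecutive vertices of the cycle; except for
   [Single], it has two further vertices [w] and [x], whose neighbours on the
   cycle are at the offsets [w_nbrs t] and [x_nbrs t]. [Full] is K_{3,3} minus
   an edge and [Triple] is K_{2,3}; [Split], [Right] and [Left] are three ways
   in which the cycle can traverse K_{3,3} minus two disjoint edges. *)
Inductive piece := Single | Triple | Full | Split | Right | Left.

Definition len t :=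
  match t with Single => 1 | Triple => 3 | _ => 4 end.
Definition w_nbrs t :=
  match t with Single => [::] | Left => [:: 1; 3] | _ => [:: 0; 2] end.
Definition x_nbrs t :=
  match t with
  | Single => [::] | Triple => [:: 1] | Right => [:: 3] | Left => [:: 0]
  | _ => [:: 1; 3]
  end.
Definition joined t := match t with Single | Split => false | _ => true end.
Definition multi t := if t is Single then false else true.

Definition changing t := match t with Single | Triple => true | _ => false end.
Definition flexible t := match t with Split | Right | Left => true | _ => false end.

Definition total l := sumn (map len l).

(** One recursion serves the geometry, with [block] for [P], and the colouring, with [proper_at];
    [tiles_cover] then finds both at the same place. *)
Fixpoint tiles (P : piece -> nat -> Prop) l d : Prop :=
  if l is t :: l' then P t d /\ tiles P l' (d + len t) else True.

Lemma tiles_cover P Q l d i : tiles P l d -> tiles Q l d -> d <= i < d + total l ->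
  exists t e s, [/\ P t e, Q t e, s < len t, i = e + s & e + len t <= d + total l].
Proof.
rewrite /total; elim: l d => [|t l IHl] d /=; first by rewrite addn0 ltnNge; case: leqP.
case=> Pt Pl [Qt Ql] /andP[di it]; case: (ltnP i (d + len t)) => lt.
  by exists t, d, (i - d); split=> //; lia.
have [|t' [e [s [Pe Qe st ie le]]]] := IHl _ Pl Ql; first by lia.
by exists t', e, s; split=> //; lia.
Qed.

Lemma tiles_sub (P Q : piece -> nat -> Prop) l d :
  (forall t e, d <= e -> P t e -> Q t e) -> tiles P l d -> tiles Q l d.
Proof.
elim: l d => [//|t l IHl] d PQ /= [Pt Pl]; split; first exact: PQ.
by apply: IHl Pl => t' e le; apply: PQ; lia.
Qed.

Lemma tiles_cat P l1 l2 d :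
  tiles P (l1 ++ l2) d -> tiles P l1 d /\ tiles P l2 (d + total l1).
Proof.
rewrite /total; elim: l1 d => [|t l IHl] d /=; first by rewrite addn0.
by case=> Pt /IHl[Pl1 Pl2]; rewrite addnA.
Qed.

Lemma total_cat l1 l2 : total (l1 ++ l2) = total l1 + total l2.
Proof. by rewrite /total map_cat sumn_cat. Qed.

Lemma total_nseq_Full i : total (nseq i Full) = 4 * i.
Proof. by rewrite /total map_nseq sumn_nseq. Qed.

Lemma tiles_nseq_Full P i d m : tiles P (nseq i Full) d -> m < i -> P Full (d + 4 * m).
Proof.
elim: i d m => [//|i IHi] d [|m] /= [Pd Pi] mi; first by rewrite addn0.
by have := IHi _ m Pi mi; rewrite -addnA -mulnS.
Qed.

(** The colours 0, 1, 2 sum to 3, so this is the remaining colour when [a] and [b] are distinct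
    colours; other values are meaningless. *)
Definition third a b := 3 - a - b.

(* [s] lists the colours of the edges of the cycle that meet a piece [t]; the
   edge leaving the cycle at offset [i] gets the third colour. *)
Definition proper_word t (s : seq nat) :=
  let o i := third (nth 0 s i) (nth 0 s i.+1) in
  [&& all (gtn 3) s,
      all (fun i => nth 0 s i != nth 0 s i.+1) (iota 0 (len t)),
      uniq (map o (w_nbrs t)), uniq (map o (x_nbrs t)) &
      joined t ==> has (fun v => v \notin map o (w_nbrs t ++ x_nbrs t)) (iota 0 3)].

(** There is one letter more than vertices, since the entering and the leaving edge both count;
    consecutive pieces share a letter. *)
Definition proper_at k t d := proper_word t (mkseq (fun i => k (d + i)) (len t).+1).

Definition allowed t (a b : nat) :=
  if changing t then a != b else if flexible t then true else a == b.

(** One explicit colouring for each allowed pair of end colours; for these, [g] occurs only when [a]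
    and [b] differ. *)
Definition word t a b : seq nat :=
  let g := third a b in
  match t with
  | Single => [:: a; b]
  | Triple => [:: a; b; g; b]
  | Full => [:: a; a.+1 %% 3; a.+2 %% 3; a.+1 %% 3; a]
  | Split | Right => if a == b then [:: a; a.+1 %% 3; a.+2 %% 3; a.+1 %% 3; a]
             else [:: a; g; b; a; b]
  | Left => if a == b then [:: a; a.+1 %% 3; a.+2 %% 3; a.+1 %% 3; a]
             else [:: a; b; a; g; b]
  end.

Lemma wordP t a b : a < 3 -> b < 3 -> allowed t a b ->
  [/\ size (word t a b) = (len t).+1, nth 0 (word t a b) 0 = a,
      nth 0 (word t a b) (len t) = b & proper_word t (word t a b)].
Proof.
by case: a => [|[|[|//]]] _; case: b => [|[|[|//]]] _; case: t => //= _; split; vm_compute.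
Qed.

(** Only the colours of the edges between consecutive pieces are chosen here; [word] fills in the
    inner ones. *)
Fixpoint reach l a b : Prop :=
  if l is t :: l' then exists x, [/\ x < 3, allowed t a x & reach l' x b] else a = b.

Lemma coloring_of_reach l a b d : a < 3 -> reach l a b ->
  exists k, [/\ k d = a, k (d + total l) = b & tiles (proper_at k) l d].
Proof.
rewrite /total; elim: l a d => [|t l IHl] a d a3 /=; first by move=> <-; exists (fun=> a).
case=> x [x3 atx /IHl-/(_ (d + len t) x3)[k [k0 kb kl]]].
have [sz w0 wl wt] := wordP a3 x3 atx; set s := word t a x in sz w0 wl wt.
(* The two colourings meet at [d + len t], where both have the value [x]. *)
exists (fun i => if i < d + len t then nth 0 s (i - d) else k i).
have lt0 : 0 < len t by case: (t).
split; first by rewrite subnn w0 ifT //; lia.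
  by rewrite addnA ifF ?kb //; lia.
split.
  rewrite /proper_at (_ : mkseq _ _ = s) //.
  apply: (@eq_from_nth _ 0); rewrite size_mkseq ?sz // => i lti; rewrite nth_mkseq //.
  case: ifP => h; first by congr nth; lia.
  have -> : i = len t by lia.
  by rewrite k0 wl.
apply: tiles_sub kl => t' e le; rewrite /proper_at.
congr (proper_word _ _); apply/eq_in_map => i _; rewrite ifF //; lia.
Qed.

(** The cases concern the tail: a tail with a flexible piece or two changing ones accepts every
    intermediate colour, a tail with just one changing piece every colour except [b], any other tail
    only [b]. In the first two cases a colour [z] different from [a] and [b] serves, unless the
    first piece is [Full]. *)
Lemma reachP l a b : a < 3 -> b < 3 ->
  (if (1 < count changing l) || has flexible l then true
   else if count changing l == 1 then a != b else a == b) -> reach l a b.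
Proof.
have avoid x y : exists z, [/\ z < 3, z != x & z != y].
  case: x => [|[|x]]; case: y => [|[|y]]; 
    solve [by exists 0 | by exists 1 | by exists 2].
elim: l a b => [|t l IHl] a b a3 b3 /=; first by move/eqP.
have [z [z3 za zb]] := avoid a b; have za' : a != z by rewrite eq_sym.
case E: ((1 < count changing l) || has flexible l); last case E1: (count changing l == 1).
- have IH x : x < 3 -> reach l x b by move=> x3; apply: IHl; rewrite ?E.
  by case: t => /= h; [exists z|exists z|exists a|exists z|exists z|exists z];
    split; rewrite /allowed /= ?eqxx //; apply: IH.
- move/norP: E => [_ /negPf Ef]; rewrite Ef (eqP E1).
  have IH x : x < 3 -> x != b -> reach l x b.
    by move=> x3 xb; apply: IHl; rewrite ?Ef ?(eqP E1).
  by case: t => /= h; [exists z|exists z|exists a|exists z|exists z|exists z];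
    split; rewrite /allowed /= ?eqxx //; apply: IH.
- have E0 : count changing l = 0 by move: E E1; lia.
  move/norP: E => [_ /negPf Ef]; rewrite Ef E0.
  have IH : reach l b b by apply: IHl; rewrite ?Ef ?E0 ?eqxx.
  by case: t => h; exists b; split=> //; exact: h.
Qed.

(** The changing pieces are exactly those of odd length. *)
Lemma odd_total l : odd (total l) = odd (count changing l).
Proof.
by rewrite /total; elim: l => //= t l IHl; rewrite !oddD IHl; case: t.
Qed.

Lemma all_Full l : count changing l = 0 -> has flexible l = false ->
  l = nseq (size l) Full.
Proof. by elim: l => //= -[] //= l IHl ? ?; congr cons; apply: IHl. Qed.

Lemma one_changing l : count changing l = 1 -> has flexible l = false ->
  exists t i j, changing t /\ l = nseq i Full ++ t :: nseq j Full.
Proof.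
elim: l => //= -[] //= l IHl; rewrite ?add0n ?add1n.
- by move=> [c0] f0; exists Single, 0, (size l); rewrite /= -all_Full.
- by move=> [c0] f0; exists Triple, 0, (size l); rewrite /= -all_Full.
- by move=> c1 /(IHl c1)[t [i [j [ct ->]]]]; exists t, i.+1, j.
Qed.

Lemma nbrs_lt t : {subset w_nbrs t <= [pred s | s < len t]} /\
  {subset x_nbrs t <= [pred s | s < len t]}.
Proof. by split; apply/allP; case: t. Qed.

Lemma proper_atP k t e (o := fun s => third (k (e + s)) (k (e + s.+1))) :
  proper_at k t e ->
  [/\ forall s, s < len t -> [&& k (e + s) < 3, k (e + s.+1) < 3 & k (e + s) != k (e + s.+1)],
      uniq (map o (w_nbrs t)), uniq (map o (x_nbrs t)) &
      joined t -> exists2 v, v < 3 & v \notin map o (w_nbrs t ++ x_nbrs t)].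
Proof.
move=> pk; have {pk} /and5P[lt3 adj uw ux jn] := pk.
have oE s : s < len t -> third (nth 0 (mkseq (fun i => k (e + i)) (len t).+1) s)
    (nth 0 (mkseq (fun i => k (e + i)) (len t).+1) s.+1) = o s.
  by move=> st; rewrite !nth_mkseq //; lia.
have [wl xl] := nbrs_lt t.
split.
- move=> s st; set f := mkseq _ _ in adj.
  have : nth 0 f s != nth 0 f s.+1 by apply: (allP adj); rewrite mem_iota.
  have k3 i : i <= len t -> k (e + i) < 3.
    move=> it; apply: (allP lt3); apply/mapP; exists i => //.
    by rewrite mem_iota.
  have st' : s < (len t).+1 by rewrite ltnW.
  by rewrite /f !nth_mkseq // => ->; rewrite !k3.
- by move: uw; congr (is_true (uniq _)); apply/eq_in_map => s /wl/oE.
- by move: ux; congr (is_true (uniq _)); apply/eq_in_map => s /xl/oE.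
- move=> jt; move: jn; rewrite jt implyTb => /hasP[v]; rewrite mem_iota => /andP[_ v3] nv.
  exists v => //; apply: contra nv => /mapP[s sin ->]; apply/mapP; exists s => //.
  by rewrite oE //; move: sin; rewrite mem_cat => /orP[/wl|/xl].
Qed.

Lemma uniq_map_inj (S T : eqType) (f : S -> T) (s : seq S) :
  uniq (map f s) -> {in s &, injective f}.
Proof.
elim: s => //= a s IHs /andP[na us] x y; rewrite !inE.
case/predU1P=> [->|xs] /predU1P[->|ys] // e; last exact: IHs.
  by rewrite e map_f in na.
by rewrite -e map_f in na.
Qed.

(** * The chains of the graphs D *)

Lemma edge_of_arcs (T : finType) (arc : rel T) (H : sgraph) (f : graph_of_arcs arc -> H) :
  (forall u v, arc u v -> edge (f u) (f v)) ->
  forall u v, edge u v -> edge (f u) (f v).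
Proof. by move=> fP u v /andP[_ /orP[/fP|/fP]] //; rewrite edge_sym. Qed.

Lemma arc_edge (T : finType) (arc : rel T) (u v : T) : u != v -> arc u v || arc v u ->
  @edge (graph_of_arcs arc) u v.
Proof. by move=> uv a; apply/andP. Qed.

(** The cycle crosses a copy from its vertex [a] to its vertex [b], at offsets 0 to 3, coded by
    their doubles. The codes 1 and 3 belong to the two vertices off the cycle, whose first
    neighbours on it have offsets 0 and 1; [placed] reads these codes in [H]. *)
Definition chain_code i (u : chain i) : nat :=
  8 * u.1 + nth 0 (if u.2.1 then [:: 6; 2; 1] else [:: 0; 4; 3]) u.2.2.

Lemma chain_code_inj i : injective (@chain_code i).
Proof.
case=> [m [b k]] [m' [b' k']]; rewrite /chain_code /= => e.
have {e} [mm bk] : m = m' :> nat /\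
    nth 0 (if b then [:: 6; 2; 1] else [:: 0; 4; 3]) k =
    nth 0 (if b' then [:: 6; 2; 1] else [:: 0; 4; 3]) k'.
  by move: e; case: b; case: b'; case: k => [[|[|[|//]]] ?] /=;
    case: k' => [[|[|[|//]]] ?] /=; lia.
have [-> kk] : b = b' /\ k = k' :> nat.
  by move: bk; case: b; case: b'; case: k => [[|[|[|//]]] ?]; case: k' => [[|[|[|//]]] ?].
by congr (_, (_, _)); apply: val_inj.
Qed.

Lemma chain_code_lt i (u : chain i) : chain_code u < 8 * i.
Proof.
case: u => [m [b k]]; rewrite /chain_code /=; have := ltn_ord m.
by case: b; case: k => [[|[|[|//]]] ?] /=; lia.
Qed.

(** A vertex of nonzero index sees the whole opposite side of its copy. One of index 0 sees two
    vertices there and one in an adjacent copy, or, at the ends of the chain, the outside vertex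
    given by the hypotheses. *)
Lemma chain_degree i (D : sgraph) (L : chain i -> D) : injective L ->
  (forall u v, chain_arc u v -> edge (L u) (L v)) ->
  (forall u, is_first_a u -> exists2 y, edge (L u) y & forall v, y != L v) ->
  (forall u, is_last_b u -> exists2 y, edge (L u) y & forall v, y != L v) ->
  forall u, exists s : seq D, [/\ uniq s, all (edge (L u)) s & 3 <= size s].
Proof.
move=> L_inj L_arc La Lb [m [b k]].
pose nb k' : chain i := (m, (~~ b, k')).
have eL k' : (k != ord0) || (k' != ord0) -> edge (L (m, (b, k))) (L (nb k')).
  rewrite /nb; case: b {nb} => kk; last first.
    by apply: L_arc; apply/orP; left; rewrite /K33m_arc /= eqxx.
  rewrite edge_sym; apply: L_arc; apply/orP; left.
  by rewrite /K33m_arc /= eqxx orbC.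
have nb_inj : injective (L \o nb) by move=> x y /= /L_inj [].
have [k0|k0] := eqVneq k ord0; last first.
  exists [seq L (nb k') | k' <- enum 'I_3]; split.
  - by rewrite (map_inj_uniq nb_inj) enum_uniq.
  - by apply/allP => _ /mapP[k' _ ->]; apply: eL; rewrite k0.
  - by rewrite size_map size_enum_ord.
suff [y ey ny] : exists2 y, edge (L (m, (b, k))) y & forall k', y != L (nb k').
  exists (y :: [seq L (nb k') | k' <- enum (predC1 (ord0 : 'I_3))]); split=> /=.
  - rewrite (map_inj_uniq nb_inj) enum_uniq andbT; apply/mapP => -[k' _ yE].
    by have := ny k'; rewrite yE eqxx.
  - rewrite ey /=; apply/allP => _ /mapP[k' + ->]; rewrite mem_enum => k'0.
    by apply: eL; apply/orP; right.
  - by rewrite size_map -cardE cardC1 card_ord.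
move: k0 eL; rewrite /nb => -> {k nb nb_inj} _; case: b => /=.
  have [mi|mi] := eqVneq m.+1 i.
    have [|y ey ny] := Lb (m, K33m_b); first by rewrite /is_last_b /= mi eqxx.
    by exists y.
  have lt : m.+1 < i by have := ltn_ord m; lia.
  exists (L (Ordinal lt, K33m_a)); first by apply: L_arc; rewrite /chain_arc /= !eqxx orbT.
  by move=> k'; apply/eqP => /L_inj /(congr1 (fun u : chain i => val u.1)) /=; lia.
have [m0|m0] := posnP m.
  have [|y ey ny] := La (m, K33m_a); first by rewrite /is_first_a /= m0 eqxx.
  by exists y.
have lt : m.-1 < i by have := ltn_ord m; lia.
exists (L (Ordinal lt, K33m_b)).
  by rewrite edge_sym; apply: L_arc; rewrite /chain_arc /= prednK // !eqxx orbT.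
by move=> k'; apply/eqP => /L_inj /(congr1 (fun u : chain i => val u.1)) /=; lia.
Qed.

Lemma chain_arc_irr i (u : chain i) : chain_arc u u = false.
Proof.
case: u => m [b k]; rewrite /chain_arc /K33m_arc /= eqxx /=.
have -> : (m == m.+1 :> nat) = false by lia.
by case: b.
Qed.

Definition D1_code i (u : D1 i) : nat :=
  if u is Some v then chain_code v else 8 * i.

Lemma D1_code_inj i : injective (@D1_code i).
Proof.
case=> [u|] [v|] //=; first by move/chain_code_inj->.
  by have := chain_code_lt u; lia.
by have := chain_code_lt v; lia.
Qed.

(** Same convention: the cycle passes [inr 0], [inl 0], [inr 1] in this order, and [inl 1], [inr 2]
    lie off it. *)
Definition K23_code (u : K23) : nat :=
  match u with inl k => nth 0 [:: 2; 1] k | inr k => nth 0 [:: 0; 4; 3] k end.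

Lemma K23_code_inj : injective K23_code.
Proof.
case=> -[[|[|[|//]]] lt] [] [[|[|[|//]]] lt'] //= _.
all: by [congr (inl _); apply: val_inj | congr (inr _); apply: val_inj].
Qed.

Lemma K23_code_lt u : K23_code u < 5.
Proof. by case: u => -[[|[|[|//]]] lt]. Qed.

Definition D5_code i (u : D5 i) : nat :=
  match u with inl v => chain_code v | inr k => 8 * i + K23_code k end.

Lemma D5_code_inj i : injective (@D5_code i).
Proof.
case=> [u|k] [v|l] /=; first by move/chain_code_inj->.
- by have := chain_code_lt u; lia.
- by have := chain_code_lt v; lia.
- by move/addnI/K23_code_inj->.
Qed.

(** * The ring of pieces along a shortest odd cycle *)

Section OddCycle.
Variables (H : sgraph) (n : nat) (c : nat -> H).
Hypothesis Hconn : connected_graph H.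
Hypothesis Hsub : subcubic H.
Hypothesis HR1 : reduced1 H.
Hypothesis HR2 : reduced2 H.
Hypothesis HR3 : reduced3 H.
Hypothesis HS333 : ~ has_subgraph (spider 3 3 3) H.
Hypothesis n_odd : odd n.
Hypothesis n_gt6 : 6 < n.
Hypothesis c_edge : forall i, edge (c i) (c i.+1).
Hypothesis c_per : forall i, c (i + n) = c i.
Hypothesis n_min : forall m (u : H), odd m -> walk m u u -> n <= m.

(** * Positions and distances on the cycle *)

Lemma c_edgeS q a b : b = a.+1 -> edge (c (q + a)) (c (q + b)).
Proof. by move=> ->; rewrite addnS. Qed.

Lemma c_edgeP q a b : a = b.+1 -> edge (c (q + a)) (c (q + b)).
Proof. by rewrite edge_sym; apply: c_edgeS. Qed.

Ltac nlia := clear -n_gt6; lia.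

Lemma c_perE i j : i = j + n -> c i = c j.
Proof. by move=> ->. Qed.

Lemma c_mod i : c (i %% n) = c i.
Proof.
rewrite {2}(divn_eq i n); elim: (i %/ n) => [|m IHm]; first by rewrite mul0n.
by rewrite mulSn -addnA addnC c_per.
Qed.

Lemma c_cong i j : i = j %[mod n] -> c i = c j.
Proof. by move=> ij; rewrite -c_mod ij c_mod. Qed.

Lemma walk_c q a l : walk l (c (q + a)) (c (q + (a + l))).
Proof. by rewrite addnA; apply: walk_of_fun => j _; apply: c_edge. Qed.

(* An odd closed walk is at least as long as [c]: parity decides which of the
   two arcs between the ends closes the given walk into an odd one. *)
Lemma geodesic l q a b : a <= b -> b <= a + n -> walk l (c (q + a)) (c (q + b)) ->
  if odd (l + (b - a)) then n <= l + (b - a) else b - a <= l.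
Proof.
move=> ab ban lw; case: ifP => o.
  apply: (n_min o); apply: walk_cat lw _; apply: walk_sym.
  by have := walk_c q a (b - a); rewrite subnKC.
have o' : odd (l + (a + n - b)).
  have e : l + (b - a) + (l + (a + n - b)) = l.*2 + n by lia.
  have : odd (l + (b - a) + (l + (a + n - b))) by rewrite e oddD odd_double n_odd.
  by rewrite oddD o.
suff : n <= l + (a + n - b) by lia.
apply: (n_min o'); apply: walk_cat lw _.
by have := walk_c q b (a + n - b); rewrite subnKC // addnA c_per.
Qed.

Lemma c_neq q a b : a < b -> b < a + n -> c (q + a) != c (q + b).
Proof.
move=> ab ban; apply/negP => e.
have := @geodesic 0 q a b (ltnW ab) (ltnW ban) e; case: ifP; lia.
Qed.

Lemma c_neq' q a b : b < a -> a < b + n -> c (q + a) != c (q + b).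
Proof. by rewrite eq_sym; apply: c_neq. Qed.

Lemma c_inj_mod i j : c i = c j -> i = j %[mod n].
Proof.
have n0 : 0 < n by lia.
rewrite -(c_mod i) -(c_mod j) => e.
have lti := ltn_pmod i n0; have ltj := ltn_pmod j n0.
apply/eqP; case: (ltngtP (i %% n) (j %% n)) => // ij.
  by have := @c_neq 0 (i %% n) (j %% n) ij; rewrite !add0n e eqxx; lia.
by have := @c_neq 0 (j %% n) (i %% n) ij; rewrite !add0n e eqxx; lia.
Qed.

Lemma c_shift i j s : c i = c j -> c (i + s) = c (j + s).
Proof. by move/c_inj_mod/eqP => ij; apply/c_cong/eqP; rewrite eqn_modDr. Qed.

(** Makes room before a vertex, so that its predecessors also have offsets in [nat]. *)
Lemma c_rebase i a : a <= n -> exists q, c i = c (q + a).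
Proof. by move=> an; exists (i + n - a); rewrite subnK ?c_per //; lia. Qed.

(** * Vertices on and off the cycle *)

Definition onC x := [exists i : 'I_n, c i == x].
Definition offC x := ~~ onC x.

Lemma onC_c i : onC (c i).
Proof.
have lt : i %% n < n by rewrite ltn_pmod //; lia.
by apply/existsP; exists (Ordinal lt); rewrite /= c_mod.
Qed.

Lemma onC_from q x : onC x -> exists2 d, d < n & x = c (q + d).
Proof.
(* Adding [q * n.-1] stands for subtracting [q] modulo [n]. *)
case/existsP=> i /eqP <-; exists ((i + q * n.-1) %% n).
  by rewrite ltn_pmod //; lia.
apply: c_cong; rewrite modnDmr.
have -> : q + (i + q * n.-1) = q * n + i by nia.
by rewrite modnMDl.
Qed.

Lemma off_neq w i : offC w -> w != c i.
Proof. by apply: contraNneq => ->; apply: onC_c. Qed.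

Lemma off_neq' w i : offC w -> c i != w.
Proof. by rewrite eq_sym; apply: off_neq. Qed.

(** By [geodesic], the walk of length 2 through [w] leaves only distances 0 and 2; the last disjunct
    is distance 2 the other way round. Walks of length 3 and 1 give [joined_nbrs] and [chord]
    likewise. *)
Lemma common_nbr w q a b : a <= b -> b < a + n ->
  edge w (c (q + a)) -> edge w (c (q + b)) -> a = b \/ b = a + 2 \/ b + 2 = a + n.
Proof.
move=> ab ban ea eb.
have /(geodesic ab (ltnW ban)) : walk 2 (c (q + a)) (c (q + b)).
  by apply: (@walk_cat _ 1 1 _ w); apply: walk_edge => //; rewrite edge_sym.
by case: ifP; clear -ab ban n_odd n_gt6; lia.
Qed.

Lemma joined_nbrs w x q a b : a <= b -> b < a + n -> edge w x ->
  edge w (c (q + a)) -> edge x (c (q + b)) ->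
  b = a + 1 \/ b = a + 3 \/ b + 1 = a + n \/ b + 3 = a + n.
Proof.
move=> ab ban ewx ea eb.
have /(geodesic ab (ltnW ban)) : walk 3 (c (q + a)) (c (q + b)).
  apply: (@walk_cat _ 1 2 _ w); first by apply: walk_edge; rewrite edge_sym.
  by apply: (@walk_cat _ 1 1 _ x); apply: walk_edge.
by case: ifP; clear -ab ban n_odd n_gt6; lia.
Qed.

Lemma chord q a b : a <= b -> b < a + n -> edge (c (q + a)) (c (q + b)) ->
  b = a + 1 \/ b + 1 = a + n.
Proof.
move=> ab ban /walk_edge /(geodesic ab (ltnW ban)).
by case: ifP; clear -ab ban n_odd n_gt6; lia.
Qed.

Lemma cycle_nbrs p y : edge (c p) y ->
  [\/ y = c (p + 1), y = c (p + n.-1) | offC y].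
Proof.
case: (boolP (onC y)) => [/(onC_from p)[d dn ->]|]; last by constructor 3.
rewrite -{1}(addn0 p) => /(@chord p 0 d isT dn)[->|e]; first by constructor 1.
by constructor 2; congr c; lia.
Qed.

Lemma c_edge_pred p : edge (c p) (c (p + n.-1)).
Proof.
have -> : c p = c (p + n.-1).+1 by rewrite -addnS prednK ?c_per //; lia.
by rewrite edge_sym.
Qed.

Lemma c_succ_pred p : c (p + 1) != c (p + n.-1).
Proof. by apply: c_neq; lia. Qed.

(** Two of the at most three edges at [c p] belong to the cycle. *)
Lemma off_nbr_unique p w x : offC w -> offC x -> edge w (c p) -> edge x (c p) -> w = x.
Proof.
move=> ow ox ew ex; apply/eqP.
have := @degree3_nbrs H (c p) (c (p + 1)) (c (p + n.-1)) w x (Hsub _).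
rewrite addn1 c_edge c_edge_pred -addn1 c_succ_pred !(off_neq' _ ow) edge_sym ew.
rewrite edge_sym ex !(negPf (off_neq _ ox)) /= => /(_ isT isT isT isT isT isT isT).
by rewrite eq_sym.
Qed.

Lemma degree2_c p : (forall w, offC w -> ~~ edge w (c p)) -> degree (c p) = 2.
Proof.
move=> no; apply: degree2 (c_edge p) (c_edge_pred p) _ _.
  by rewrite -addn1 c_succ_pred.
move=> y ey; case: (cycle_nbrs ey); rewrite ?addn1; try tauto.
by move/no; rewrite edge_sym ey.
Qed.

(** * Components outside the cycle *)

Ltac distinct :=
  rewrite /= !inE !negb_or; do ?[apply/andP; split];
  try solve [ done | assumption | by rewrite eq_sym | by apply: off_neq | by apply: off_neq'
        | apply: c_neq; clear -n_gt6; lia | apply: c_neq'; clear -n_gt6; lia ].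

(** Otherwise [w], [x], [y] form one leg of an S_{3,3,3} whose other legs run along the cycle in
    both directions; these occupy seven vertices, distinct because [n] exceeds 6. *)
Lemma off_path_ends w x y i : offC w -> offC x -> edge w (c i) -> edge w x ->
  edge x y -> y != w -> onC y.
Proof.
move=> ow ox; have [q ->] : exists q, c i = c (q + 3) by apply: c_rebase; lia.
move=> ewc ewx exy yw; case: (boolP (onC y)) => // oy; case: HS333.
have xw : x != w by apply/eqP => xw; rewrite xw edge_irr in ewx.
have yx : y != x by apply/eqP => yx; rewrite yx edge_irr in exy.
apply: (@spider333 _ (c (q + 3)) w x y (c (q + 4)) (c (q + 5)) (c (q + 6))
   (c (q + 2)) (c (q + 1)) (c (q + 0))) => //.
all: try by [rewrite edge_sym | apply: c_edgeS | apply: c_edgeP].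
distinct.
Qed.

(** By (R1) [x] has a second neighbour, which [off_path_ends] puts on the cycle. The path [x], [w],
    [y] then leaves the cycle there, against the same lemma. *)
Lemma off_nbr_off_unique w x y i : offC w -> edge w (c i) -> offC x -> edge w x ->
  offC y -> edge w y -> x = y.
Proof.
move=> ow ewc ox ewx oy ewy; apply/eqP/negPn/negP => xy.
have exw : edge x w by rewrite edge_sym.
have [x' exx' x'w] := degree_neq1_nbr (@HR1 _) exw.
have /(onC_from 0)[j _ x'c] := off_path_ends ow ox ewc ewx exx' x'w.
rewrite x'c in exx'.
have := off_path_ends ox ow exx' exw ewy; rewrite eq_sym xy => /(_ isT).
by apply/negP.
Qed.

(** The set [D] of vertices on the cycle or adjacent to it is closed under adjacency: one step
    further out, (R1) gives another edge, which must return to the cycle. *)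
Lemma off_has_nbr_on w : offC w -> exists i, edge w (c i).
Proof.
pose D x := onC x || [exists i : 'I_n, edge x (c i)].
have Dc x i : edge x (c i) -> D x.
  have lt : i %% n < n by rewrite ltn_pmod //; lia.
  by move=> e; apply/orP; right; apply/existsP; exists (Ordinal lt); rewrite /= c_mod.
have Dcl x y : D x -> edge x y -> D y.
  move=> Dx exy; case: (boolP (onC y)) => oy; first by rewrite /D oy.
  case: (boolP (onC x)) => ox.
    have [i _ xc] := onC_from 0 ox; apply: (@Dc _ (0 + i)).
    by rewrite -xc edge_sym.
  move: Dx; rewrite /D (negPf ox) /= => /existsP[i exc].
  have eyx : edge y x by rewrite edge_sym.
  have [y' eyy' y'x] := degree_neq1_nbr (@HR1 _) eyx.
  have /(onC_from 0)[j _ y'c] := off_path_ends ox oy exc exy eyy' y'x.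
  by rewrite y'c in eyy'; apply: Dc eyy'.
move=> ow; have : D w.
  have /connectP[p] := Hconn (c 0) w; have : D (c 0) by rewrite /D onC_c.
  elim: p (c 0) => [|x p IHp] v Dv /=; first by move=> _ ->.
  by case/andP=> /(Dcl _ _ Dv) Dx; apply: IHp.
by rewrite /D (negPf ow) => /existsP[i ?]; exists i.
Qed.

(** * Recognition of the pieces *)

Lemma two_c_nbrs w i b : edge w (c i) -> edge w b -> onC b -> b != c i ->
  exists q, [/\ edge w (c q), edge w (c (q + 2)) & c i = c q /\ b = c (q + 2) \/
    c i = c (q + 2) /\ b = c q].
Proof.
move=> ei eb /(onC_from i)[d dn bd] bi; subst b.
have ei' := ei; rewrite -(addn0 i) in ei'.
have d0 : d != 0 by apply: contraNneq bi => ->; rewrite addn0.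
have := common_nbr (leq0n d) dn ei' eb; case=> [|[|]] => e.
- by rewrite e eqxx in d0.
- by exists i; rewrite e in eb *; split=> //; left.
- have E : c i = c (i + d + 2) by rewrite -addnA e c_per.
  by exists (i + d); rewrite -E; split=> //; right.
Qed.

(** A third neighbour would lie two before the first and two after the second, which would make 6 a
    multiple of [n]. *)
Lemma two_c_nbrs_exact w q a : a + 2 < n ->
  edge w (c (q + a)) -> edge w (c (q + (a + 2))) ->
  forall s, s < n -> edge w (c (q + s)) = (s \in [:: a; a + 2]).
Proof.
move=> an ea ea2 s sn; apply/idP/idP => [es|]; last first.
  by rewrite !inE => /orP[]/eqP->.
rewrite !inE.
have h1 : s <= a \/ a <= s by lia.
have h2 : s <= a + 2 \/ a + 2 <= s by lia.
have lt1 : s < a + n by lia.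
have lt2 : a < s + n by lia.
have lt3 : s < a + 2 + n by lia.
have lt4 : a + 2 < s + n by lia.
case: h1 => h1; [have := common_nbr h1 lt2 es ea | have := common_nbr h1 lt1 ea es];
case: h2 => h2; [have := common_nbr h2 lt4 es ea2 | have := common_nbr h2 lt3 ea2 es
  | have := common_nbr h2 lt4 es ea2 | have := common_nbr h2 lt3 ea2 es];
clear -an n_gt6 n_odd sn; lia.
Qed.

Lemma c_nbrs_shift v q k (S : seq nat) : k <= n ->
  (forall d, d < n -> edge v (c (q + d)) = (d \in S)) ->
  forall s, s < n -> edge v (c (q + k + s)) = ((if k + s < n then k + s else k + s - n) \in S).
Proof.
move=> kn vS s sn; rewrite -addnA; case: ifP => lt; first exact: vS.
rewrite -vS; last by lia.
by rewrite -[in RHS]c_per; congr (edge _ (c _)); lia.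
Qed.

(** The equivalences over all [s < n] fix every neighbour of [w] and [x] on the cycle; the last
    three fields say that no other vertex off the cycle touches the piece. *)
Record attached t p w x : Prop := Attached {
  att_w : offC w;
  att_x : offC x;
  att_wx : edge w x = joined t;
  att_wc : forall s, s < n -> edge w (c (p + s)) = (s \in w_nbrs t);
  att_xc : forall s, s < n -> edge x (c (p + s)) = (s \in x_nbrs t);
  att_w_off : forall y, offC y -> edge w y -> y = x;
  att_x_off : forall y, offC y -> edge x y -> y = w;
  att_c_off : forall s y, s < len t -> offC y -> edge y (c (p + s)) -> y = w \/ y = x
}.

Definition block t p : Prop :=
  if multi t then exists w x, attached t p w x
  else forall w, offC w -> ~~ edge w (c p).

Lemma attached_split w x q : offC w -> offC x ->
  (forall y, offC y -> ~~ edge w y) -> (forall y, offC y -> ~~ edge x y) ->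
  edge w (c q) -> edge w (c (q + 2)) -> edge x (c (q + 1)) -> edge x (c (q + 3)) ->
  attached Split q w x.
Proof.
move=> ow ox wo xo w0 w2 x1 x3; rewrite -(addn0 q) in w0; split=> //.
- by apply/negbTE/wo.
- by apply: two_c_nbrs_exact => //; lia.
- by apply: two_c_nbrs_exact => //; lia.
- by move=> y oy; rewrite (negPf (wo _ oy)).
- by move=> y oy; rewrite (negPf (xo _ oy)).
- case=> [|[|[|[|//]]]] y _ oy ey.
  + left; exact: off_nbr_unique ey w0.
  + right; exact: off_nbr_unique ey x1.
  + left; exact: off_nbr_unique ey w2.
  + right; exact: off_nbr_unique ey x3.
Qed.

Lemma isolated_off_nbrs w : offC w -> (forall y, offC y -> ~~ edge w y) ->
  forall i, edge w (c i) -> exists q, [/\ edge w (c q), edge w (c (q + 2)) &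
    c i = c q \/ c i = c (q + 2)].
Proof.
move=> ow wo i ei; have [b eb bi] := degree_neq1_nbr (@HR1 _) ei.
have ob : onC b by apply: contraTT eb; apply: wo.
have [q [? ? h]] := two_c_nbrs ei eb ob bi.
by exists q; split=> //; case: h => -[? ?]; [left | right].
Qed.

Lemma classify_isolated w i : offC w -> (forall y, offC y -> ~~ edge w y) ->
  edge w (c i) -> exists q x, attached Split q w x \/ attached Split q x w.
Proof.
move=> ow wo ei; have [q0 [w0 w2 _]] := isolated_off_nbrs ow wo ei.
have [q qE] : exists q, forall s, c (q0 + s) = c (q + (3 + s)).
  by exists (q0 + n - 3) => s; apply/esym/c_perE; nlia.
have {}w0 : edge w (c (q + 3)) by rewrite -[q0]addn0 qE in w0.
have {}w2 : edge w (c (q + 5)) by rewrite qE in w2.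
have wE : forall s, s < n -> edge w (c (q + s)) = (s \in [:: 3; 5]).
  by apply: two_c_nbrs_exact => //; lia.
(* Otherwise [w] and [c (q + 4)] are opposite vertices of degree 2 in an induced 4-cycle, against
   (R3). *)
have [x [ox x4]] : exists x, offC x /\ edge x (c (q + 4)).
  case: (pickP (fun x => offC x && edge x (c (q + 4)))) => [x /andP[? ?]|no]; first by exists x.
  have d4 : degree (c (q + 4)) = 2.
    by apply: degree2_c => x ox; have := no x; rewrite ox /= => ->.
  have dw : degree w = 2.
    apply: degree2 w0 w2 _ _; first by apply: c_neq; lia.
    move=> y ey; have oy : onC y by apply: contraTT ey; apply: wo.
    have [d dn yd] := onC_from q oy; move: ey; rewrite yd wE // !inE.
    by case/orP=> /eqP->; [left|right].
  case: HR3; exists w, (c (q + 3)), (c (q + 4)), (c (q + 5)); split=> //.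
  have e34 : edge (c (q + 3)) (c (q + 4)) by apply: c_edgeS.
  have e45 : edge (c (q + 4)) (c (q + 5)) by apply: c_edgeS.
  have n35 : edge (c (q + 3)) (c (q + 5)) = false.
    by apply/negP => /(@chord q 3 5 isT); lia.
  have nw4 : edge w (c (q + 4)) = false by rewrite wE //; nlia.
  apply: induced_c4 => //; [by rewrite edge_sym | by rewrite nw4 | by rewrite n35 |
    exact: off_neq | by apply: c_neq; nlia].
have xw : x != w by apply/eqP => xw; move: x4; rewrite xw wE //; lia.
(* Otherwise [c (q + 3)] is the centre of an S_{3,3,3}: one leg starts with [w], one goes through
   [c (q + 4)] to [x] and [y], and one runs back along the cycle. *)
have xo y : offC y -> ~~ edge x y.
  move=> oy; apply/negP => exy; apply: HS333.
  have yw : y != w by apply/eqP => yw; have := wo x ox; rewrite edge_sym -yw exy.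
  have yx : y != x by apply/eqP => yx; rewrite yx edge_irr in exy.
  apply: (@spider333 _ (c (q + 3)) w (c (q + 5)) (c (q + 6)) (c (q + 4)) x y
     (c (q + 2)) (c (q + 1)) (c (q + 0))) => //.
  all: try by [rewrite edge_sym | apply: c_edgeS | apply: c_edgeP].
  distinct.
(* The second neighbour of [x] lies two after or two before [c (q + 4)]; in the latter case [x]
   takes the role of [w]. *)
have [r [xr0 xr2 [] rE]] := isolated_off_nbrs ox xo x4.
  exists (q + 3), x; left; apply: attached_split => //; rewrite -?addnA //.
  by rewrite (_ : 3 + 3 = 4 + 2) // addnA (c_shift 2 rE).
exists (q + 2), x; right; apply: attached_split => //; rewrite -?addnA //.
suff -> : c (q + 2) = c r by [].
have := c_shift (n - 2) rE; rewrite (@c_perE (q + 4 + _) (q + 2)); last by nlia.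
by rewrite (@c_perE (r + 2 + _) r) //; nlia.
Qed.

(** Otherwise each has just one neighbour on the cycle, and two vertices of degree 2 are adjacent,
    against (R2). *)
Lemma joined_has_two_c_nbrs w x : offC w -> offC x -> edge w x ->
  (exists p, edge w (c p) /\ edge w (c (p + 2))) \/
  (exists p, edge x (c p) /\ edge x (c (p + 2))).
Proof.
have two u v i : offC u -> offC v -> edge u v -> edge u (c i) ->
    (exists p, edge u (c p) /\ edge u (c (p + 2))) \/ degree u = 2.
  move=> ou ov euv ei.
  case: (pickP (fun y => edge u y && (y != v) && (y != c i))) => [y /andP[/andP[eu yv] yi]|no].
    have oy : onC y.
      case: (boolP (onC y)) => // oy.
      by rewrite (off_nbr_off_unique ou ei oy eu ov euv) eqxx in yv.
    by have [p [? ? _]] := two_c_nbrs ei eu oy yi; left; exists p.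
  right; apply: degree2 euv ei _ _; first exact: off_neq.
  move=> y eu; have := no y; rewrite eu /= => /negbT; rewrite negb_and !negbK.
  by case/orP=> /eqP->; [left | right].
move=> ow ox ewx; have exw : edge x w by rewrite edge_sym.
have [i ei] := off_has_nbr_on ow; have [j ej] := off_has_nbr_on ox.
case: (two _ _ _ ow ox ewx ei) => [|dw]; first by left.
case: (two _ _ _ ox ow exw ej) => [|dx]; first by right.
by case: HR2; exists w, x.
Qed.

(** With the neighbours of [u] at offsets 3 and 5, those of [v] are at distance 1 or 3 from both,
    hence among 2, 4, 6; and 2 and 6, four apart, do not occur together. *)
Lemma classify_joined u v p : offC u -> offC v -> edge u v ->
  edge u (c p) -> edge u (c (p + 2)) ->
  exists t q, multi t /\ (attached t q u v \/ attached t q v u).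
Proof.
move=> ou ov euv up up2; have evu : edge v u by rewrite edge_sym.
have u_off y : offC y -> edge u y -> y = v.
  by move=> oy ey; apply: (off_nbr_off_unique ou up).
have [jv ejv] := off_has_nbr_on ov.
have v_off y : offC y -> edge v y -> y = u.
  by move=> oy ey; apply: (off_nbr_off_unique ov ejv).
have [q qE] : exists q, forall s, c (p + s) = c (q + (3 + s)).
  by exists (p + n - 3) => s; apply/esym/c_perE; nlia.
have u3 : edge u (c (q + 3)) by rewrite -[p]addn0 qE in up.
have u5 : edge u (c (q + 5)) by rewrite qE in up2.
have uE : forall s, s < n -> edge u (c (q + s)) = (s \in [:: 3; 5]).
  by apply: two_c_nbrs_exact => //; nlia.
have v246 d : d < n -> edge v (c (q + d)) -> [|| d == 2, d == 4 | d == 6].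
  move=> dn vd; have l3 : 3 < d + n by nlia.
  have l5 : 5 < d + n by nlia.
  have d3 : d < 3 + n by move: dn; nlia.
  have d5 : d < 5 + n by move: dn; nlia.
  case: (leqP 3 d) => h3; [have := joined_nbrs h3 d3 euv u3 vd | have := joined_nbrs (ltnW h3) l3 evu vd u3];
  case: (leqP 5 d) => h5; [have := joined_nbrs h5 d5 euv u5 vd | have := joined_nbrs (ltnW h5) l5 evu vd u5
    | have := joined_nbrs h5 d5 euv u5 vd | have := joined_nbrs (ltnW h5) l5 evu vd u5];
  clear -n_gt6 n_odd dn; lia.
have v26 : ~ (edge v (c (q + 2)) /\ edge v (c (q + 6))).
  by case=> v2 v6; have := @common_nbr v q 2 6 isT _ v2 v6; clear -n_gt6 n_odd; lia.
have vE (S : seq nat) :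
    (2 \in S) = edge v (c (q + 2)) -> (4 \in S) = edge v (c (q + 4)) ->
    (6 \in S) = edge v (c (q + 6)) -> all (fun d => d \in [:: 2; 4; 6]) S ->
    forall d, d < n -> edge v (c (q + d)) = (d \in S).
  move=> S2 S4 S6 Sall d dn; apply/idP/idP => [vd|dS].
    by case/or3P: (v246 _ dn vd) => /eqP dE; move: vd; rewrite dE ?S2 ?S4 ?S6.
  by move: (dS) (allP Sall _ dS); rewrite !inE => + /or3P[]/eqP dE; rewrite dE ?S2 ?S4 ?S6.
have [d dn vd] : exists2 d, d < n & edge v (c (q + d)).
  by have [d dn E] := onC_from q (onC_c jv); exists d; rewrite -?E.
(* If [v] has its only neighbour on the cycle at [q + 2] or [q + 6], then
   [c (q + 4)] has degree 2: a neighbour [y] of it off the cycle would give an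
   S_{3,3,3} centred at [c (q + 4)] or at one of its neighbours. *)
have mid y : offC y -> edge y (c (q + 4)) -> ~~ edge v (c (q + 4)) ->
    [/\ y != u, y != v & (exists y', [/\ offC y', edge y y', y' != u & y' != v]) \/
      edge y (c (q + 6)) \/ edge y (c (q + 2))].
  move=> oy y4 v4.
  have yu : y != u by apply/eqP => yu; move: y4; rewrite yu uE //; nlia.
  have yv : y != v by apply/eqP => yv; move: v4; rewrite -yv y4.
  have [y' yy' y'4] := degree_neq1_nbr (@HR1 _) y4.
  split=> //; case: (boolP (onC y')) => oy'; last first.
    left; exists y'; split=> //; apply/eqP => e.
      by move/eqP: yv; apply; apply: u_off; rewrite // -e edge_sym.
    by move/eqP: yu; apply; apply: v_off; rewrite // -e edge_sym.
  right; have [d' dn' dE] := onC_from q oy'; move: yy' y'4; rewrite dE => yd ne.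
  have d4 : d' != 4 by apply: contraNneq ne => ->.
  have lt1 : d' < 4 + n by move: dn'; nlia.
  have lt2 : 4 < d' + n by nlia.
  have : d' = 6 \/ d' = 2.
    case: (leqP 4 d') => h4.
      by have := common_nbr h4 lt1 y4 yd; clear -n_gt6 dn' d4; lia.
    by have := common_nbr (ltnW h4) lt2 yd y4; clear -n_gt6 dn' d4; lia.
  by case=> d'E; rewrite -d'E; [left | right].
have uv : u != v by apply/eqP => uv; rewrite uv edge_irr in euv.
have v26F : edge v (c (q + 2)) && edge v (c (q + 6)) = false.
  by apply/negP => /andP.
(* The neighbours of [v] determine the piece: 2, 4 and 4, 6 give [Full], 2 alone [Left], 4 alone
   [Triple], 6 alone [Right]. *)
case e2: (edge v (c (q + 2))); case e4: (edge v (c (q + 4))); case e6: (edge v (c (q + 6))).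
all: try by rewrite e2 e6 in v26F.
- have {}vE := vE [:: 2; 4] (esym e2) (esym e4) (esym e6) isT.
  exists Full, (q + 2); split=> //; right; split=> //.
  + move=> s sn; rewrite (@c_nbrs_shift v q 2 [:: 2; 4]) //; last by nlia.
    by rewrite !inE; case: ifP; move: sn; nlia.
  + move=> s sn; rewrite (@c_nbrs_shift u q 2 [:: 3; 5]) //; last by nlia.
    by rewrite !inE; case: ifP; move: sn; nlia.
  + by case=> [|[|[|[|//]]]] y _ oy; rewrite -addnA => ey; [left|right|left|right];
      apply: off_nbr_unique ey _.
- have {}vE := vE [:: 2] (esym e2) (esym e4) (esym e6) isT.
  exists Left, (q + 2); split=> //; left; split=> //.
  + move=> s sn; rewrite (@c_nbrs_shift u q 2 [:: 3; 5]) //; last by nlia.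
    by rewrite !inE; case: ifP; move: sn; nlia.
  + move=> s sn; rewrite (@c_nbrs_shift v q 2 [:: 2]) //; last by nlia.
    by rewrite !inE; case: ifP; move: sn; nlia.
  + case=> [|[|[|[|//]]]] y _ oy; rewrite -addnA => ey.
    * by right; apply: off_nbr_unique ey _.
    * by left; apply: off_nbr_unique ey _.
    * case: HS333.
      have [yu yv [[y' [oy' yy' y'u y'v]]|[y6|y2]]] := mid y oy ey (negbT e4).
      -- have y'y : y' != y by apply/eqP => e; rewrite e edge_irr in yy'.
         apply: (@spider333 _ (c (q + 5)) u v (c (q + 2)) (c (q + 4)) y y'
           (c (q + 6)) (c (q + 7)) (c (q + 8))) => //.
         all: try by [rewrite edge_sym | apply: c_edgeS | apply: c_edgeP].
         distinct.
      -- apply: (@spider333 _ (c (q + 4)) y (c (q + 6)) (c (q + 7)) (c (q + 3)) (c (q + 2)) (c (q + 1))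
           (c (q + 5)) u v) => //.
         all: try by [rewrite edge_sym | apply: c_edgeS | apply: c_edgeP].
         distinct.
      -- by rewrite (off_nbr_unique oy ov y2 e2) eqxx in yv.
    * by left; apply: off_nbr_unique ey _.
- have {}vE := vE [:: 4; 6] (esym e2) (esym e4) (esym e6) isT.
  exists Full, (q + 3); split=> //; left; split=> //.
  + move=> s sn; rewrite (@c_nbrs_shift u q 3 [:: 3; 5]) //; last by nlia.
    by rewrite !inE; case: ifP; move: sn; nlia.
  + move=> s sn; rewrite (@c_nbrs_shift v q 3 [:: 4; 6]) //; last by nlia.
    by rewrite !inE; case: ifP; move: sn; nlia.
  + by case=> [|[|[|[|//]]]] y _ oy; rewrite -addnA => ey; [left|right|left|right];
      apply: off_nbr_unique ey _.
- have {}vE := vE [:: 4] (esym e2) (esym e4) (esym e6) isT.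
  exists Triple, (q + 3); split=> //; left; split=> //.
  + move=> s sn; rewrite (@c_nbrs_shift u q 3 [:: 3; 5]) //; last by nlia.
    by rewrite !inE; case: ifP; move: sn; nlia.
  + move=> s sn; rewrite (@c_nbrs_shift v q 3 [:: 4]) //; last by nlia.
    by rewrite !inE; case: ifP; move: sn; nlia.
  + by case=> [|[|[|//]]] y _ oy; rewrite -addnA => ey; [left|right|left];
      apply: off_nbr_unique ey _.
- have {}vE := vE [:: 6] (esym e2) (esym e4) (esym e6) isT.
  exists Right, (q + 3); split=> //; left; split=> //.
  + move=> s sn; rewrite (@c_nbrs_shift u q 3 [:: 3; 5]) //; last by nlia.
    by rewrite !inE; case: ifP; move: sn; nlia.
  + move=> s sn; rewrite (@c_nbrs_shift v q 3 [:: 6]) //; last by nlia.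
    by rewrite !inE; case: ifP; move: sn; nlia.
  + case=> [|[|[|[|//]]]] y _ oy; rewrite -addnA => ey.
    * by left; apply: off_nbr_unique ey _.
    * case: HS333.
      have [yu yv [[y' [oy' yy' y'u y'v]]|[y6|y2]]] := mid y oy ey (negbT e4).
      -- have y'y : y' != y by apply/eqP => e; rewrite e edge_irr in yy'.
         apply: (@spider333 _ (c (q + 3)) u v (c (q + 6)) (c (q + 4)) y y'
           (c (q + 2)) (c (q + 1)) (c (q + 0))) => //.
         all: try by [rewrite edge_sym | apply: c_edgeS | apply: c_edgeP].
         distinct.
      -- by rewrite (off_nbr_unique oy ov y6 e6) eqxx in yv.
      -- apply: (@spider333 _ (c (q + 4)) y (c (q + 2)) (c (q + 1)) (c (q + 5)) (c (q + 6)) (c (q + 7))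
           (c (q + 3)) u v) => //.
         all: try by [rewrite edge_sym | apply: c_edgeS | apply: c_edgeP].
         distinct.
    * by left; apply: off_nbr_unique ey _.
    * by right; apply: off_nbr_unique ey _.
- have := v246 _ dn vd; move: vd => /[swap] /or3P[]/eqP->; rewrite ?e2 ?e4 ?e6 //.
Qed.

Lemma attached_nbr t p w x y i : attached t p w x -> y = w \/ y = x ->
  edge y (c i) -> exists2 s, s < len t & c i = c (p + s).
Proof.
move=> att yE ey; have [d dn dE] := onC_from p (onC_c i); exists d => //.
by move: ey; rewrite dE; case: yE => ->; rewrite ?(att_wc att) ?(att_xc att) //;
  case: (nbrs_lt t) => lw lx; [apply: lw | apply: lx].
Qed.

Lemma attached_mem t p w x s : attached t p w x -> s < len t ->
  (s \in w_nbrs t) || (s \in x_nbrs t) ->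
  exists2 y, offC y & edge y (c (p + s)).
Proof.
move=> att slt; have sn : s < n by case: t {att} slt => /=; nlia.
case/orP=> [sw|sx]; [exists w; first exact: att_w att | exists x; first exact: att_x att].
  by rewrite (att_wc att).
by rewrite (att_xc att).
Qed.

Lemma attached_cong t p q w x : c p = c q -> attached t p w x -> attached t q w x.
Proof.
move=> pq [ow ox wx wc xc wo xo co]; have E s := c_shift s (esym pq).
by split=> // [s|s|s y]; rewrite E; [apply: wc | apply: xc | apply: co].
Qed.

Lemma classify w i : offC w -> edge w (c i) ->
  exists t q w' x', [/\ multi t, attached t q w' x' & w = w' \/ w = x'].
Proof.
move=> ow ei; case: (pickP (fun x => offC x && edge w x)) => [x /andP[ox ewx]|no]; last first.
  have wo y : offC y -> ~~ edge w y by move=> oy; have := no y; rewrite oy /= => ->.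
  have [q [x [att|att]]] := classify_isolated ow wo ei.
    by exists Split, q, w, x; split=> //; left.
  by exists Split, q, x, w; split=> //; right.
have exw : edge x w by rewrite edge_sym.
have [[p [p0 p2]]|[p [p0 p2]]] := joined_has_two_c_nbrs ow ox ewx.
  have [t [q [mt [att|att]]]] := classify_joined ow ox ewx p0 p2.
    by exists t, q, w, x; split=> //; left.
  by exists t, q, x, w; split=> //; right.
have [t [q [mt [att|att]]]] := classify_joined ox ow exw p0 p2.
  by exists t, q, x, w; split=> //; right.
by exists t, q, w, x; split=> //; left.
Qed.

(** * Cutting the cycle between pieces *)

(** Cutting the cycle just before [c p] splits no piece. *)
Definition boundary p := forall t q w x s, multi t -> attached t q w x ->
  s < len t -> c p = c (q + s) -> s = 0.

Lemma boundary_cong p q : c p = c q -> boundary p -> boundary q.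
Proof. by move=> pq bp t r w x s mt att st; rewrite -pq; apply: bp mt att st. Qed.

(* Every inner boundary of a piece is straddled by two adjacencies to the same
   or to adjacent outer vertices, at offsets [a] and [b]. *)
Lemma attached_straddle t p w x s : attached t p w x -> 0 < s < len t ->
  exists a b y z, [/\ a < s <= b, b < len t, edge y (c (p + a)), edge z (c (p + b)) &
    [/\ offC y, offC z & y = z \/ edge y z]].
Proof.
move=> att st; have ow := att_w att; have ox := att_x att.
have wc := att_wc att; have xc := att_xc att; have wx := att_wx att.
have [n0 n1 n2 n3] : [/\ 0 < n, 1 < n, 2 < n & 3 < n] by split; nlia.
have ww a b : a \in w_nbrs t -> b \in w_nbrs t -> a < s <= b -> b < len t -> b < n ->
  exists a b y z, [/\ a < s <= b, b < len t, edge y (c (p + a)), edge z (c (p + b)) &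
    [/\ offC y, offC z & y = z \/ edge y z]].
  move=> aw bw ab bl bn; exists a, b, w, w; rewrite !wc //; first by split=> //; split=> //; left.
  by case/andP: ab => lt1 lt2; apply: ltn_trans lt1 (leq_ltn_trans lt2 bn).
have xx a b : a \in x_nbrs t -> b \in x_nbrs t -> a < s <= b -> b < len t -> b < n ->
  exists a b y z, [/\ a < s <= b, b < len t, edge y (c (p + a)), edge z (c (p + b)) &
    [/\ offC y, offC z & y = z \/ edge y z]].
  move=> aw bw ab bl bn; exists a, b, x, x; rewrite !xc //; first by split=> //; split=> //; left.
  by case/andP: ab => lt1 lt2; apply: ltn_trans lt1 (leq_ltn_trans lt2 bn).
case: t att st wc xc wx ww xx => att; case: s => [|[|[|[|//]]]] //= _ wc xc wx ww xx.
all: try by apply: (ww 0 2).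
all: try by apply: (xx 1 3).
all: try by apply: (ww 1 3).
- exists 2, 3, w, x; rewrite wc // xc //; split=> //; split=> //; by right.
- exists 0, 1, x, w; rewrite wc // xc //; split=> //; split=> //; right; by rewrite edge_sym.
Qed.

(** If another piece straddled the end, the vertex [y] of [attached_straddle] would be [w] or [x],
    being adjacent to the first piece. Then so would [z], which however has a neighbour beyond that
    end. *)
Lemma boundary_end t q w x : multi t -> attached t q w x -> boundary (q + len t).
Proof.
move=> mt att t' q' w' x' s mt' att' st' E; apply/eqP; rewrite -leqn0 leqNgt; apply/negP => s0.
have [|a [b [y [z [ab bt ea eb [oy oz yz]]]]]] := attached_straddle att' (s := s).
  by rewrite s0.
have Lt : 3 <= len t <= 4 by case: t mt {att E}.
have Lt' : len t' <= 4 by case: t' {mt' att' st' bt}.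
have Ea : c (q' + a) = c (q + (len t - (s - a))).
  have h1 : q' + s + (n - (s - a)) = q' + a + n by move: ab st' Lt'; nlia.
  have h2 : q + len t + (n - (s - a)) = q + (len t - (s - a)) + n by move: ab st' Lt' Lt; nlia.
  by rewrite -(c_perE h1) -(c_perE h2); apply/esym/c_shift.
have Eb : c (q' + b) = c (q + (len t + (b - s))).
  have -> : q' + b = q' + s + (b - s) by move: ab; nlia.
  by rewrite addnA; apply/esym/c_shift.
have yE : y = w \/ y = x.
  rewrite Ea in ea; apply: (att_c_off att) ea => //; move: ab Lt; nlia.
have zE : z = w \/ z = x.
  case: yz => [<- //|eyz]; case: yE => yE; rewrite yE in eyz.
    by right; apply: (att_w_off att).
  by left; apply: (att_x_off att).
rewrite Eb in eb; have [r rt] := attached_nbr att zE eb.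
apply/eqP; apply: c_neq'; move: ab rt Lt Lt' bt; nlia.
Qed.

(** A piece that meets [c p] starts there. If there is none, [c p] is a [Single]; a piece straddling
    its end would start at [c p] and give it a neighbour off the cycle. *)
Lemma boundary_step p : boundary p -> exists t, block t p /\ boundary (p + len t).
Proof.
move=> bp; case: (pickP (fun w => offC w && edge w (c p))) => [w /andP[ow ew]|no].
  have [t [q [w' [x' [mt att wE]]]]] := classify ow ew.
  have [s st sE] := attached_nbr att wE ew.
  have s0 := bp _ _ _ _ _ mt att st sE; rewrite s0 addn0 in sE.
  have att' := attached_cong (esym sE) att.
  exists t; split; last by apply: boundary_end att'.
  by rewrite /block mt; exists w', x'.
exists Single; split; first by move=> w ow; have := no w; rewrite ow /= => ->.
move=> t q w x [|s] // mt att st E.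
have E' : c p = c (q + s).
  have h1 : p + 1 + n.-1 = p + n by nlia.
  have h2 : q + s.+1 + n.-1 = q + s + n by nlia.
  by rewrite -(c_perE h1) -(c_perE h2); apply: c_shift.
have s0 := bp _ _ _ _ _ mt att (ltnW st) E'; rewrite s0 in E'.
have [|y oy ey] := attached_mem att (ltnW st); first by rewrite s0; case: t mt {att st}.
by have := no y; rewrite oy E' -s0 ey.
Qed.

Lemma block_multi t p : multi t -> block t p -> exists w x, attached t p w x.
Proof. by rewrite /block => ->. Qed.

(** By (R2) [c 0] and [c 1] do not both have degree 2, so there is a piece, and its end is a
    boundary. *)
Lemma exists_boundary : exists p, boundary p.
Proof.
suff [i [w [ow ei]]] : exists i w, offC w /\ edge w (c i).
  have [t [q [w' [x' [mt att _]]]]] := classify ow ei.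
  by exists (q + len t); apply: boundary_end att.
case: (pickP (fun w => offC w && edge w (c 0))) => [w /andP[? ?]|no0]; first by exists 0, w.
case: (pickP (fun w => offC w && edge w (c 1))) => [w /andP[? ?]|no1]; first by exists 1, w.
case: HR2; exists (c 0), (c 1); split=> //; apply: degree2_c => w ow.
  by have := no0 w; rewrite ow /= => ->.
by have := no1 w; rewrite ow /= => ->.
Qed.

Lemma block_tiling p m d : boundary (p + d) -> boundary (p + (d + m)) ->
  exists2 l, tiles (fun t e => block t (p + e)) l d & total l = m.
Proof.
have [M] := ubnP m; elim: M m d => // M IHM m d mM bd bm.
case: (posnP m) => [->|m0]; first by exists [::].
have [t [bt bt']] := boundary_step bd; have lt0 : 0 < len t by case: (t).
(* A piece running past the last position would have that boundary in its interior. *)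
have lem : len t <= m.
  rewrite leqNgt; apply/negP => lt.
  have mt : multi t by move: lt m0; case: (t) => //=; lia.
  move: bt; rewrite /block mt => -[w [x att]].
  have m_0 := bm t (p + d) w x m mt att lt (congr1 c (addnA p d m)).
  by rewrite m_0 in m0.
have [|||l tl lE] := IHM (m - len t) (d + len t).
- by lia.
- by rewrite addnA.
- by rewrite -addnA subnKC.
exists (t :: l) => //; rewrite /total /= in lE *; lia.
Qed.

Lemma attached_pos t p e w x a : attached t (p + e) w x -> e + len t <= n -> a < n ->
  (edge w (c (p + a)) -> exists2 s, s \in w_nbrs t & a = e + s) /\
  (edge x (c (p + a)) -> exists2 s, s \in x_nbrs t & a = e + s).
Proof.
move=> att en an; have [s sn sE] := onC_from (p + e) (onC_c (p + a)).
have [lw lx] := nbrs_lt t.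
have inj : s < len t -> a = e + s.
  move=> st; apply/eqP; move: sE; rewrite -addnA => /eqP; apply: contraLR => ne.
  case: (ltngtP a (e + s)) ne => // lt _; [apply: c_neq|apply: c_neq'] => //.
    by move: st en an; nlia.
  by move: st en an; nlia.
by rewrite sE (att_wc att) // (att_xc att) //; split=> st; exists s => //;
  apply: inj; [apply: lw | apply: lx].
Qed.

(** * The colouring of a ring of pieces *)

(* [k d] is the colour of the edge from [c (p + d - 1)] to [c (p + d)]. *)
Lemma coloring_of_tiling p l k :
  tiles (fun t e => block t (p + e)) l 0 -> total l = n ->
  tiles (proper_at k) l 0 -> k 0 = k n -> edge_colorable H 3.
Proof.
move=> bl ln pl k0n.
pose o d := third (k d) (k d.+1).
have kP d : d < n -> [&& k d < 3, k d.+1 < 3 & k d != k d.+1].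
  move=> dn; have [|t [e [s [_ /proper_atP[+ _ _ _] st -> _]]]] := tiles_cover (i := d) bl pl.
    by rewrite add0n ln.
  by move=> /(_ s st); rewrite addnS.
have oP d : d < n -> [/\ o d < 3, o d != k d & o d != k d.+1].
  move=> /kP; rewrite /o /third; case: (k d) => [|[|[|//]]]; case: (k d.+1) => [|[|[|//]]] //.
have off_block w : offC w -> exists t e w1 x1,
    [/\ attached t (p + e) w1 x1, proper_at k t e, e + len t <= n & w = w1 \/ w = x1].
  move=> ow; have [i ei] := off_has_nbr_on ow; have [d dn dE] := onC_from p (onC_c i).
  have [|t [e [s [Pe Qe st de le]]]] := tiles_cover (i := d) bl pl; first by rewrite add0n ln.
  rewrite dE de in ei; case: (boolP (multi t)) => mt.
    have [w1 [x1 att]] := block_multi mt Pe; exists t, e, w1, x1; split=> //.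
      by rewrite -ln.
    by apply: (att_c_off att st ow); rewrite -addnA.
  have tE : t = Single by case: (t) mt.
  have s0 : s = 0 by move: st; rewrite tE; case: (s).
  by move: Pe => /=; rewrite tE => /(_ w ow); rewrite -[p + e]addn0 -s0 -addnA ei.
(* The default [n] marks the vertices off the cycle. *)
pose pos x := if [pick i : 'I_n | x == c (p + i)] is Some i then nat_of_ord i else n.
have pos_on d : d < n -> pos (c (p + d)) = d.
  move=> dn; rewrite /pos; case: pickP => [i /eqP e|/(_ (Ordinal dn))]; last by rewrite eqxx.
  apply/eqP; move/eqP: e; apply: contraLR => ne; have := ltn_ord i.
  by case: (ltngtP i d) ne => // lt _ ilt; [apply: c_neq'|apply: c_neq] => //; move: dn ilt; nlia.
have pos_off x : offC x -> pos x = n.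
  by move=> ox; rewrite /pos; case: pickP => // i; rewrite (negPf (off_neq _ ox)).
(* A colour is bad at [x] if an edge from [x] to the cycle has it; [z] is the first colour that is
   bad at neither end. *)
pose bad v x := [exists i : 'I_n, edge x (c (p + i)) && (o i == v)].
pose z x y := find (fun v => ~~ bad v x && ~~ bad v y) (iota 0 3).
(* An edge of the cycle takes its colour at its later end. The closing edge, from position [n.-1] to
   0, gets [k n], which equals [k 0]. *)
pose g x y := if pos x < n
  then if pos y < n then if pos y == (pos x).+1 %% n then k (pos x).+1 else k (pos y).+1
       else o (pos x)
  else if pos y < n then o (pos y) else z x y.
have gS d : d < n -> g (c (p + d)) (c (p + d.+1)) = k d.+1 /\
                     g (c (p + d.+1)) (c (p + d)) = k d.+1.
  move=> dn; have pS : pos (c (p + d.+1)) = d.+1 %% n.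
    have [dn'|nd] := ltnP d.+1 n; first by rewrite modn_small // pos_on.
    have dE : d.+1 = n by lia.
    have -> : c (p + d.+1) = c (p + 0) by rewrite addn0 dE.
    by rewrite dE modnn pos_on //; nlia.
  rewrite /g pos_on // pS dn ltn_mod (ltn_trans _ n_gt6) // eqxx; split=> //.
  rewrite ifF //; have [dn'|nd] := ltnP d.+1 n.
    rewrite (modn_small dn'); have [dn''|nd] := ltnP d.+2 n.
      by rewrite modn_small //; lia.
    have dE : d.+2 = n by lia.
    by rewrite dE modnn; move: dE; nlia.
  have dE : d.+1 = n by lia.
  by rewrite dE modnn modn_small; move: dE; nlia.
have g_off d y : d < n -> offC y -> g (c (p + d)) y = o d /\ g y (c (p + d)) = o d.
  by move=> dn oy; rewrite /g pos_on // pos_off // dn ltnn.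
have gC d y : d < n -> edge (c (p + d)) y ->
    [\/ [/\ y = c (p + d + 1), g (c (p + d)) y = k d.+1 & g y (c (p + d)) = k d.+1],
        [/\ y = c (p + d + n.-1), g (c (p + d)) y = k d & g y (c (p + d)) = k d] |
        [/\ offC y, g (c (p + d)) y = o d & g y (c (p + d)) = o d]].
  move=> dn /cycle_nbrs[->|->|oy].
  - by constructor 1; rewrite addn1 -addnS; have [] := gS d dn.
  - constructor 2; case: d dn => [|d] dn.
      have n1 : n.-1 < n by nlia.
      have [] := gS _ n1; rewrite (_ : n.-1.+1 = n) ?c_per ?addn0 -?k0n //.
      by nlia.
    have [] := gS d (ltnW dn).
    by rewrite (@c_perE (p + d.+1 + n.-1) (p + d)) //; nlia.
  - by constructor 3; have [] := g_off d y dn oy.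
(* All neighbours of [w] on the cycle lie in one piece, whose word is proper. *)
have o_inj w a b : offC w -> edge w (c (p + a)) -> edge w (c (p + b)) ->
    a < n -> b < n -> o a = o b -> a = b.
  move=> ow ea eb an bn oE.
  have [t [e [w1 [x1 [att /proper_atP[_ uw ux _] en wE]]]]] := off_block _ ow.
  have [wa xa] := attached_pos att en an; have [wb xb] := attached_pos att en bn.
  by case: wE => E; subst w; [have [s sS sE] := wa ea; have [r rS rE] := wb eb; move: uw
    | have [s sS sE] := xa ea; have [r rS rE] := xb eb; move: ux] => /uniq_map_inj h;
    rewrite sE rE (h s r) //; move: oE; rewrite /o sE rE !addnS.
have zP x y : offC x -> offC y -> edge x y ->
    [/\ z x y < 3, ~~ bad (z x y) x & ~~ bad (z x y) y].
  move=> ox oy exy.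
  have ok : has (fun v => ~~ bad v x && ~~ bad v y) (iota 0 3).
    have [t [e [w1 [x1 [att /proper_atP[_ _ _ jn] en xE]]]]] := off_block _ ox.
    have [jt xy] : joined t /\ (x = w1 /\ y = x1 \/ x = x1 /\ y = w1).
      case: xE => xE; rewrite xE in exy.
        have yE := att_w_off att oy exy; split; last by left.
        by rewrite -(att_wx att) -yE.
      have yE := att_x_off att oy exy; split; last by right.
      by rewrite -(att_wx att) -yE edge_sym.
    have [v v3 nv] := jn jt; apply/hasP; exists v; first by rewrite mem_iota.
    have good y' : y' = w1 \/ y' = x1 -> ~~ bad v y'.
      move=> y'E; apply: contra nv => /existsP[i /andP[ei /eqP <-]].
      have [wi xi] := attached_pos att en (ltn_ord i).
      have [s sS ->] : exists2 s, s \in w_nbrs t ++ x_nbrs t & nat_of_ord i = e + s.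
        case: y'E ei => -> => [/wi|/xi] [s sS sE]; exists s => //;
        by rewrite mem_cat sS ?orbT.
      by apply/mapP; exists s; rewrite ?addnS.
    by apply/andP; case: xy => -[-> ->]; split; apply: good; tauto.
  have z3 : z x y < 3 by rewrite has_find in ok.
  by have := nth_find 0 ok; rewrite -/(z x y) nth_iota // add0n => /andP[].
have z_sym x y : z x y = z y x by apply: eq_find => v; rewrite andbC.
have g_sym x y : edge x y -> g x y = g y x.
  move=> exy; case: (boolP (onC x)) => [/(onC_from p)[d dn xE]|ox].
    by subst x; case: (gC d y dn exy) => -[_ -> ->].
  case: (boolP (onC y)) => [/(onC_from p)[d dn yE]|oy].
    by subst y; have [-> ->] := g_off d x dn ox.
  by rewrite /g !pos_off // ltnn z_sym.
have g3 x y : edge x y -> g x y < 3.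
  move=> exy; case: (boolP (onC x)) => [/(onC_from p)[d dn xE]|ox].
    have /and3P[k1 k2 _] := kP d dn; have [o3 _ _] := oP d dn.
    by subst x; case: (gC d y dn exy) => -[_ -> _].
  case: (boolP (onC y)) => [/(onC_from p)[d dn yE]|oy].
    by subst y; have [_ ->] := g_off d x dn ox; have [] := oP d dn.
  by rewrite /g !pos_off // ltnn; have [] := zP x y ox oy exy.
have g_proper x y y' : edge x y -> edge x y' -> y != y' -> g x y != g x y'.
  move=> exy exy' ne; case: (boolP (onC x)) => [/(onC_from p)[d dn xE]|ox].
    subst x; have /and3P[_ _ kk] := kP d dn; have [_ ok ok'] := oP d dn.
    case: (gC d y dn exy) => -[yE -> _]; case: (gC d y' dn exy') => -[y'E -> _] //;
      rewrite 1?eq_sym //.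
    - by rewrite yE y'E eqxx in ne.
    - by rewrite yE y'E eqxx in ne.
    - rewrite edge_sym in exy; rewrite edge_sym in exy'.
      by rewrite (off_nbr_unique yE y'E exy exy') eqxx in ne.
  have o_bad d u : d < n -> edge x (c (p + d)) -> offC u -> edge x u -> o d != z x u.
    move=> dn ed ou eu; have [_ nb _] := zP x u ox ou eu; apply: contra nb => /eqP <-.
    by apply/existsP; exists (Ordinal dn); rewrite /= ed eqxx.
  have gz u : offC u -> g x u = z x u by move=> ou; rewrite /g !pos_off // ltnn.
  have gc d : d < n -> g x (c (p + d)) = o d by move=> dn; have [] := g_off d x dn ox.
  case: (boolP (onC y)) => [/(onC_from p)[d dn yE]|oy];
    case: (boolP (onC y')) => [/(onC_from p)[d' dn' y'E]|oy'].
  - subst y y'; rewrite !gc //; apply: contra ne => /eqP oE.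
    by rewrite (o_inj x d d').
  - by subst y; rewrite gc // gz //; apply: o_bad.
  - by subst y'; rewrite gc // gz // eq_sym; apply: o_bad.
  - have [i ei] := off_has_nbr_on ox.
    by rewrite (off_nbr_off_unique ox ei oy exy oy' exy') eqxx in ne.
apply: (@edge_coloring_of_pairs H 2 (fun x y => inord (g x y))) => [x y /g_sym-> //|x y y' exy exy' ne].
apply: contra (g_proper x y y' exy exy' ne) => /eqP/(congr1 val) /=.
by rewrite !inordK ?g3 // => ->.
Qed.

(** * Rings that resist the colouring *)

Lemma block_cong t p q : c p = c q -> block t p -> block t q.
Proof.
rewrite /block => pq; case: ifP => _; last by rewrite pq.
by case=> w [x att]; exists w, x; apply: attached_cong att.
Qed.

(** Once round from a boundary, the end colours must agree. By [reachP] this can be achieved unless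
    no piece is flexible and exactly one is changing. *)
Lemma tiling_or_coloring : edge_colorable H 3 \/
  exists p i t, [/\ changing t, n = 4 * i + len t, block t (p + 4 * i) &
    forall m, m < i -> block Full (p + 4 * m)].
Proof.
have [p bp] := exists_boundary.
have [||l tl ln] := @block_tiling p n 0; rewrite ?addn0 //.
  by rewrite add0n; apply: boundary_cong bp; rewrite c_per.
case E: ((1 < count changing l) || has flexible l).
  left; have [|k [k0 kn kl]] := @coloring_of_reach l 0 0 0 isT; first by apply: reachP; rewrite ?E.
  have k0n : k 0 = k n by rewrite k0 -kn add0n ln.
  exact: coloring_of_tiling tl ln kl k0n.
right; move/norP: E => [c1 /negPf nf].
(* The number of changing pieces has the parity of [n], so it is not 0. *)
have {}c1 : count changing l = 1.
  by have := odd_total l; rewrite ln n_odd; move: c1; case: (count _ _) => [|[]].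
have [t [i [j [ct lE]]]] := one_changing c1 nf.
rewrite lE !total_cat /= total_nseq_Full in ln *; rewrite lE in tl.
have {tl} [ti /= [bt tj]] := tiles_cat tl.
have tot : total (t :: nseq j Full) = len t + 4 * j by rewrite -total_nseq_Full.
rewrite tot total_nseq_Full add0n in ln bt tj.
(* The ring is restarted just after the changing piece, which thereby comes last. *)
exists (p + (4 * i + len t)), (j + i), t; split=> //; first by lia.
  apply: block_cong bt; apply/esym/c_perE; lia.
move=> m mi; case: (ltnP m j) => mj.
  by have := tiles_nseq_Full tj mj; rewrite !addnA.
have mi' : m - j < i by lia.
by apply: block_cong (tiles_nseq_Full ti mi'); apply/esym/c_perE; lia.
Qed.

(** * Isomorphisms with the graphs D *)

(* [v] encodes [c (p + d)] by [2 d], and a vertex off the cycle by [2 d + 1],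
   where [c (p + d)] is its first neighbour. *)
Definition placed p (y : H) v :=
  if odd v then [/\ offC y, edge y (c (p + v./2)) &
    forall j, j < v./2 -> ~~ edge y (c (p + j))]
  else y = c (p + v./2).

Lemma placed_inj p y v v' : v < 2 * n -> v' < 2 * n ->
  placed p y v -> placed p y v' -> v = v'.
Proof.
move=> vn v'n; rewrite /placed; case o: (odd v); case o': (odd v').
- case=> _ e lt [_ e' lt']; case: (ltngtP v./2 v'./2) => [/lt'|/lt|]; rewrite ?e ?e' //.
  by clear -o o'; lia.
- by case=> oy _ _ yE; have := off_neq (p + v'./2) oy; rewrite yE eqxx.
- by move=> yE [oy _ _]; have := off_neq (p + v./2) oy; rewrite yE eqxx.
- move=> -> /eqP e; case: (ltngtP v./2 v'./2) => lt; last by clear -o o' lt; lia.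
    suff : c (p + v./2) != c (p + v'./2) by rewrite e.
    by apply: c_neq => //; clear -vn v'n lt; lia.
  suff : c (p + v./2) != c (p + v'./2) by rewrite e.
  by apply: c_neq' => //; clear -vn v'n lt; lia.
Qed.

(** Stated for [Full] and [Triple] at once. As the piece ends by position [n], none of its
    neighbours on the cycle wraps round to a smaller position. *)
Lemma attached_placed t p e w x : attached t (p + e) w x -> e + len t <= n ->
  w_nbrs t = [:: 0; 2] -> 1 \in x_nbrs t -> 0 \notin x_nbrs t ->
  placed p w (2 * e + 1) /\ placed p x (2 * e + 3).
Proof.
move=> att en wt x1 x0.
have L3 : 3 <= len t by case: t {att en} wt x1 x0.
have o1 : odd (2 * e + 1) by lia.
have o3 : odd (2 * e + 3) by lia.
have h1 : (2 * e + 1)./2 = e + 0 by lia.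
have h3 : (2 * e + 3)./2 = e + 1 by lia.
rewrite /placed o1 o3 h1 h3; split; split; rewrite ?(att_w att) ?(att_x att) //.
- by rewrite addnA (att_wc att) ?wt //; nlia.
- move=> j je; apply/negP => ej; have [|wj _] := attached_pos (a := j) att en; first by lia.
  by have [s _] := wj ej; lia.
- by rewrite addnA (att_xc att) ?x1 //; nlia.
- move=> j je; apply/negP => ej; have [|_ xj] := attached_pos (a := j) att en; first by lia.
  have [[|s] sx] := xj ej; last by lia.
  by rewrite sx in x0.
Qed.

Section Chain.
Variables (p i : nat) (W : 'I_i -> H * H).
Hypothesis att_W : forall m : 'I_i, attached Full (p + 4 * m) (W m).1 (W m).2.
Hypothesis in_le : 4 * i <= n.

(** Index 2 falls outside the lists, so the default of [nth] supplies the vertex off the cycle. *)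
Definition chain_map (u : chain i) : H :=
  let q := p + 4 * u.1 in
  if u.2.1 then nth (W u.1).1 [:: c (q + 3); c (q + 1)] u.2.2
  else nth (W u.1).2 [:: c q; c (q + 2)] u.2.2.

Lemma chain_map_arc u v : chain_arc u v -> edge (chain_map u) (chain_map v).
Proof.
case: u v => [m [b k]] [m' [b' k']]; rewrite /chain_arc /chain_map /=.
case/orP=> [/andP[/eqP <-]|/and3P[/eqP mm /eqP[-> ->] /eqP[-> ->]]]; last first.
  by rewrite mm /= -addnA; apply: c_edgeS; lia.
have att := att_W m; have wx := att_wx att.
have [n0 n1 n2 n3] : [/\ 0 < n, 1 < n, 2 < n & 3 < n] by split; nlia.
have w0 := att_wc att n0; have w2 := att_wc att n2.
have x1 := att_xc att n1; have x3 := att_xc att n3.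
have c01 : edge (c (p + 4 * m)) (c (p + 4 * m + 1)) by rewrite addn1.
have c12 : edge (c (p + 4 * m + 1)) (c (p + 4 * m + 2)) by apply: c_edgeS.
have c23 : edge (c (p + 4 * m + 2)) (c (p + 4 * m + 3)) by apply: c_edgeS.
rewrite addn0 in w0; case/and3P; case: b b' => [] // [] // _ _.
case: k => [[|[|[|//]]] ?]; case: k' => [[|[|[|//]]] ?] //= _; by rewrite edge_sym.
Qed.

Lemma chain_map_placed u : placed p (chain_map u) (chain_code u).
Proof.
case: u => [m [b k]]; have ltm := ltn_ord m.
have [||||pw px] := attached_placed (att_W m) => //=; first by lia.
rewrite /chain_map /chain_code /=.
have oE j : odd (8 * m + 2 * j) = false by clear; lia.
have hE j : p + (8 * m + 2 * j)./2 = p + 4 * m + j by clear; lia.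
case: b; case: k => [[|[|[|//]]] ?] /=.
- by rewrite /placed (oE 3) (hE 3).
- by rewrite /placed (oE 1) (hE 1).
- by rewrite mulnA in pw.
- by rewrite /placed (oE 0) (hE 0) addn0.
- by rewrite /placed (oE 2) (hE 2).
- by rewrite mulnA in px.
Qed.

End Chain.

Lemma block_full_witness p i : (forall m, m < i -> block Full (p + 4 * m)) ->
  exists W : 'I_i -> H * H, forall m : 'I_i, attached Full (p + 4 * m) (W m).1 (W m).2.
Proof.
move=> bF.
have ex (m : 'I_i) : exists wx : H * H, attached Full (p + 4 * m) wx.1 wx.2.
  by have [w [x att]] := bF m (ltn_ord m); exists (w, x).
by have [W att_W] := fin_all_exists ex; exists W.
Qed.

(** Codes give injectivity. For [iso_of_covering], a chain vertex already has three neighbours, the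
    maximum, and the vertex [c (p + 4 * i)] has degree 2. *)
Lemma iso_D1 p i : n = 4 * i + 1 -> block Single (p + 4 * i) ->
  (forall m, m < i -> block Full (p + 4 * m)) -> iso H (D1 i).
Proof.
move=> nE bS /block_full_witness[W att_W]; have i1 : 0 < i by lia.
have in_le : 4 * i <= n by lia.
pose f (u : D1 i) := if u is Some v then chain_map p W v else c (p + 4 * i).
pose code := @D1_code i; have code_inj := @D1_code_inj i : injective code.
have code_lt u : code u < 2 * n.
  by case: u => [u|] /=; [have := chain_code_lt u|]; lia.
have f_placed u : placed p (f u) (code u).
  case: u => [u|] /=; first exact: chain_map_placed.
  have o : odd (8 * i) = false by clear; lia.
  by rewrite /placed o; congr (c (p + _)); lia.
have last_a u : is_last_b u -> edge (chain_map p W u) (c (p + 4 * i)).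
  case: u => m [b k] /andP[/eqP /= mi /eqP /= [-> ->]]; rewrite /chain_map /= -addnA.
  by apply: c_edgeS; clear -mi; lia.
have first_a u : is_first_a u -> edge (c (p + 4 * i)) (chain_map p W u).
  case: u => m [b k] /andP[/eqP /= m0 /eqP /= [-> ->]]; rewrite /chain_map /= m0 muln0 addn0.
  (* The ring closes: [p + 4 * i + 1] is [p + n]. *)
  by rewrite -[c p]c_per; apply: c_edgeS; clear -nE; lia.
apply: (@iso_of_covering (D1 i) H f None) => //.
- by move=> u v fuv; apply/code_inj/(placed_inj (code_lt u) (code_lt v) (f_placed u)); rewrite fuv.
- apply: edge_of_arcs => -[u|] [v|] //=.
  + exact: chain_map_arc.
  + exact: last_a.
  + exact: first_a.
- case=> [u|].
    have [||||s [us es s3]] := @chain_degree i (D1 i) Some _ _ _ _ u.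
    + exact: Some_inj.
    + move=> v w vw; apply: arc_edge; rewrite /= ?vw //.
      by apply/eqP => /Some_inj E; rewrite E chain_arc_irr in vw.
    + by move=> v fv; exists None => //; apply: arc_edge; rewrite //= fv orbT.
    + by move=> v lv; exists None => //; apply: arc_edge; rewrite //= lv.
    by exists s; split=> //; apply: leq_trans (Hsub _) s3.
  have lt0 : i.-1 < i by rewrite ltn_predL.
  have lb : is_last_b (Ordinal lt0, K33m_b) by rewrite /is_last_b /= prednK ?eqxx.
  have fa : is_first_a (Ordinal i1, K33m_a) by [].
  exists [:: Some (Ordinal i1, K33m_a); Some (Ordinal lt0, K33m_b)]; split.
  - by rewrite -(map_inj_uniq code_inj) /= /chain_code /= !inE; lia.
  - by apply/allP => y; rewrite !inE => /orP[]/eqP->; apply: arc_edge; rewrite //= ?fa ?lb ?orbT.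
  - by rewrite /= degree2_c.
Qed.

Lemma iso_D5 p i : n = 4 * i + 3 -> block Triple (p + 4 * i) ->
  (forall m, m < i -> block Full (p + 4 * m)) -> iso H (D5 i).
Proof.
move=> nE [w [x att]] /block_full_witness[W att_W]; have i1 : 0 < i by lia.
have in_le : 4 * i <= n by lia.
have [n0 n1 n2] : [/\ 0 < n, 1 < n & 2 < n] by split; nlia.
have w0 := att_wc att n0; have w2 := att_wc att n2; have x1 := att_xc att n1.
have wx := att_wx att; rewrite addn0 in w0.
pose f (u : D5 i) := match u with
  | inl v => chain_map p W v
  | inr (inl k) => nth w [:: c (p + 4 * i + 1)] k
  | inr (inr k) => nth x [:: c (p + 4 * i); c (p + 4 * i + 2)] k
  end.
pose code := @D5_code i; have code_inj := @D5_code_inj i : injective code.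
have code_lt u : code u < 2 * n.
  case: u => [u|k] /=; first by have := chain_code_lt u; clear -nE; lia.
  by have := K23_code_lt k; clear -nE; lia.
have f_placed u : placed p (f u) (code u).
  have oE j : odd (8 * i + 2 * j) = false by clear; lia.
  have hE j : p + (8 * i + 2 * j)./2 = p + 4 * i + j by clear; lia.
  have [||||pw px] := attached_placed att => //=; first by rewrite nE.
  case: u => [u|[k|k]] /=; first exact: chain_map_placed.
    case: k => [[|[|//]] ?] /=; first by rewrite /placed (oE 1) (hE 1).
    by rewrite mulnA in pw.
  case: k => [[|[|[|//]]] ?] /=.
  - by rewrite /placed (oE 0) (hE 0) addn0.
  - by rewrite /placed (oE 2) (hE 2).
  - by rewrite mulnA in px.
have pE : K23_p = inr ord0 by congr inr; apply: val_inj; rewrite /= inordK.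
have rE : K23_r = inr (Ordinal (isT : 1 < 3)) by congr inr; apply: val_inj; rewrite /= inordK.
have last_p u : is_last_b u -> edge (chain_map p W u) (c (p + 4 * i)).
  case: u => m [b k] /andP[/eqP /= mi /eqP /= [-> ->]]; rewrite /chain_map /= -addnA.
  by apply: c_edgeS; clear -mi; lia.
have first_r u : is_first_a u -> edge (c (p + 4 * i + 2)) (chain_map p W u).
  case: u => m [b k] /andP[/eqP /= m0 /eqP /= [-> ->]]; rewrite /chain_map /= m0 muln0 addn0.
  by rewrite -[c p]c_per -addnA; apply: c_edgeS; clear -nE; lia.
have c01 : edge (c (p + 4 * i)) (c (p + 4 * i + 1)) by rewrite addn1.
have c12 : edge (c (p + 4 * i + 1)) (c (p + 4 * i + 2)) by apply: c_edgeS.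
apply: (@iso_of_covering (D5 i) H f (inr K23_p)) => //.
- by move=> u v fuv; apply/code_inj/(placed_inj (code_lt u) (code_lt v) (f_placed u)); rewrite fuv.
- apply: edge_of_arcs => -[u|u] [v|v] /=.
  + exact: chain_map_arc.
  + by rewrite pE => /andP[lu /eqP->]; apply: last_p.
  + by rewrite rE => /andP[/eqP-> fv]; apply: first_r.
  + case: u v => [[[|[|//]] ?]|?] // [//|[[|[|[|//]]] ?]] //= _; by rewrite edge_sym.
- have lt0 : i.-1 < i by rewrite ltn_predL.
  pose t : D5 i := inr (inr (Ordinal (isT : 2 < 3))).
  have qs (k : 'I_2) (j : 'I_3) : @edge (D5 i) (inr (inl k)) (inr (inr j)) by [].
  have sq (k : 'I_2) (j : 'I_3) : @edge (D5 i) (inr (inr j)) (inr (inl k)) by [].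
  have lb : @edge (D5 i) (inr (inr ord0)) (inl (Ordinal lt0, K33m_b)).
    rewrite edge_sym; apply: arc_edge => //; apply/orP; left.
    by rewrite /D5_arc pE eqxx andbT /is_last_b /= prednK // !eqxx.
  have fa : @edge (D5 i) (inr (inr (Ordinal (isT : 1 < 3)))) (inl (Ordinal i1, K33m_a)).
    by apply: arc_edge => //; apply/orP; left; rewrite /D5_arc rE eqxx.
  case=> [u|[k|k]].
  + have [||||s [us es s3]] := @chain_degree i (D5 i) inl _ _ _ _ u.
    * exact: inl_inj.
    * move=> v v' vv; apply: arc_edge; rewrite /= ?vv //.
      by apply/eqP => E; rewrite (inl_inj E) chain_arc_irr in vv.
    * move=> v fv; exists (inr K23_r) => //; apply: arc_edge; rewrite //= eqxx fv orbT //.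
    * move=> v lv; exists (inr K23_p) => //; apply: arc_edge; rewrite //= eqxx lv //.
    by exists s; split=> //; apply: leq_trans (Hsub _) s3.
  + exists [seq inr (inr j) | j <- enum 'I_3]; split.
    * by rewrite map_inj_uniq ?enum_uniq // => ? ? [].
    * by apply/allP => _ /mapP[j _ ->].
    * by rewrite size_map size_enum_ord.
  + pose qq : D5 i := inr (inl ord0). pose ss : D5 i := inr (inl (Ordinal (isT : 1 < 2))).
    case: k => [[|[|[|//]]] lt].
    * exists [:: qq; ss; inl (Ordinal lt0, K33m_b)]; split=> //.
      rewrite (_ : Ordinal lt = ord0); last exact: val_inj.
      by apply/allP => y; rewrite !inE => /or3P[]/eqP->.
    * exists [:: qq; ss; inl (Ordinal i1, K33m_a)]; split=> //.
      rewrite (_ : Ordinal lt = Ordinal (isT : 1 < 3)); last exact: val_inj.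
      by apply/allP => y; rewrite !inE => /or3P[]/eqP->.
    (* This vertex is sent to [x], which has only the neighbours [w] and [c (p + 4 * i + 1)]. *)
    * exists [:: qq; ss]; split=> //.
      rewrite /f /=.
      rewrite (@degree2 _ x w (c (p + 4 * i + 1))) //.
      -- by rewrite edge_sym.
      -- by apply: off_neq; apply: (att_w att).
      -- move=> y xy; case: (boolP (onC y)) => [|oy]; last by left; apply: (att_x_off att).
         case/(onC_from (p + 4 * i)) => d dn yE; right; move: xy.
         by rewrite yE (att_xc att) //= inE => /eqP->.
Qed.

Lemma odd_cycle_cases :
  (exists2 i : nat, 1 <= i & iso H (D1 i)) \/
  (exists2 i : nat, 1 <= i & iso H (D5 i)) \/
  edge_colorable H 3.
Proof.
have [?|[p [i [t [ct nE bt bF]]]]] := tiling_or_coloring; first by right; right.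
(* For [i = 0] the cycle would have length 1 or 3. *)
have i1 : 1 <= i by case: i t ct nE {bt bF} => // -[] //= _ nE; move: n_gt6; rewrite nE.
case: t ct nE bt => //= _ nE bt.
  by left; exists i => //; apply: iso_D1 nE bt bF.
by right; left; exists i => //; apply: iso_D5 nE bt bF.
Qed.

End OddCycle.

(** * From a shortest odd closed walk to the conclusion *)

(** A repeated vertex would split the walk into two shorter closed walks, one of them odd. *)
Lemma cycle_of_shortest_odd_walk (H : sgraph) (f : nat -> H) n : 2 < n -> odd n ->
  (forall m (u : H), odd m -> walk m u u -> n <= m) ->
  f n = f 0 -> (forall i, i < n -> edge (f i) (f i.+1)) -> has_cycle_of_length H n.
Proof.
move=> n2 on nmin fn fe; have n0 : 0 < n by lia.
exists (mkseq f n); last by rewrite size_mkseq.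
rewrite /is_cycle size_mkseq n2 andTb; apply/andP; split.
  have fpath a m : a + m <= n -> path (@edge H) (f a) [seq f j | j <- iota a.+1 m].
    elim: m a => //= m IHm a am; rewrite fe ?IHm //; lia.
  have [m nm] : exists m, n = m.+1 by exists n.-1; rewrite prednK.
  have iotaE : iota 1 n = rcons (iota 1 m) n by rewrite nm -{1}(addn1 m) iotaD cats1 add1n.
  rewrite {1}nm /= -[X in rcons _ X]fn -map_rcons -iotaE.
  exact: fpath.
apply/(uniqP (f 0)) => i j; rewrite !inE size_mkseq => lti ltj; rewrite !nth_mkseq //.
wlog ij : i j lti ltj / i < j.
  move=> wl; case: (ltngtP i j) => // [lt|lt] e; first exact: wl.
  by apply/esym/wl.
move=> e; exfalso.
have w1 : walk (j - i) (f i) (f i).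
  by have := @walk_of_fun H f i (j - i); rewrite subnKC ?(ltnW ij) // -e; apply=> k lk; apply: fe; lia.
have w2 : walk (n - j + i) (f i) (f i).
  apply: (@walk_cat _ _ _ _ (f 0)).
    have := @walk_of_fun H f j (n - j); rewrite subnKC ?(ltnW ltj) // fn -e; apply=> k lk; apply: fe; lia.
  by have := @walk_of_fun H f 0 i; rewrite add0n; apply=> k lk; apply: fe; lia.
case o: (odd (j - i)); first by have := nmin _ _ o w1; lia.
have {}o : odd (n - j + i) by lia.
by have := nmin _ _ o w2; lia.
Qed.

Theorem theorem5 (H : sgraph)
  (Hconn : connected_graph H) (Hsub : subcubic H) (Htri : triangle_free H)
  (HR1 : reduced1 H) (HR2 : reduced2 H) (HR3 : reduced3 H) (HR4 : reduced4 H)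
  (HS333 : ~ has_subgraph (spider 3 3 3) H)
  (HC5 : ~ has_cycle_of_length H 5) :
  (exists2 i : nat, 1 <= i & iso H (D1 i)) \/
  (exists2 i : nat, 1 <= i & iso H (D5 i)) \/
  edge_colorable H 3.
Proof.
case: (odd_closed_walk_or_2coloring Hconn) => [ex|[side side_edge]]; last first.
  have [g [g_sym g_proper]] := @konig_edge_coloring H 2 side _ (@edge_sym H) side_edge Hsub.
  by right; right; apply: edge_coloring_of_pairs g_sym g_proper.
case: (ex_minnP ex) => n /andP[n_odd /existsP[u uu]] n_least.
have n_min m (v : H) : odd m -> walk m v v -> n <= m.
  by move=> om vv; apply: n_least; rewrite om; apply/existsP; exists v.
have [f [f0 fn fe]] := walkP uu.
(* Length 1 would be a loop; 3 and 5 would give the excluded cycles. *)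
have n_gt6 : 6 < n.
  have n1 : n != 1.
    apply/eqP => n1; move: uu; rewrite n1 => /existsP[v /andP[/[swap] /eqP ->]].
    by rewrite edge_irr.
  have cyc : 2 < n -> has_cycle_of_length H n.
    by move=> n2; apply: cycle_of_shortest_odd_walk n2 n_odd n_min _ fe; rewrite f0 fn.
  have n3 : n != 3 by apply/eqP => n3; rewrite n3 in cyc; exact: Htri (cyc isT).
  have n5 : n != 5 by apply/eqP => n5; rewrite n5 in cyc; exact: HC5 (cyc isT).
  by clear -n1 n3 n5 n_odd; lia.
have n0 : 0 < n by apply: leq_trans n_gt6.
(* The walk is extended periodically to all indices. *)
apply: (@odd_cycle_cases H n (fun i => f (i %% n))) => // [i|i]; last by rewrite modnDr.
have lt := ltn_pmod i n0; rewrite -addn1 -modnDml addn1.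
have [lt1|ge] := ltnP (i %% n).+1 n; first by rewrite (modn_small lt1); apply: fe.
have E : (i %% n).+1 = n by apply/eqP; rewrite eqn_leq lt ge.
by move: (fe _ lt); rewrite E modnn fn f0.
Qed.
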